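(* Let $\mathcal{B}_0$ be a $C^*$-algebra, $(\lambda_t)_{t\ge0}$ a semigroup of injective endomorphisms of $\mathcal{B}_0$ and $\psi$ a $(\lambda_t)$-invariant state on $\mathcal{B}_0$. Let $Q=\mathrm{s\text{-}lim}_{t\to-\infty}F_{t]}$, where $F_{t]}$ is the support projection of the vector state of $\Omega$ in $\pi(\mathcal{B}_{[t})''$, and let $(\mathcal{A}_0,\tau_t,\psi_0)$ be the reduced Markov semigroup on the support projection of $\psi$ (all defined in the context). Then $Q$ is pure, i.e. $Q=|\Omega\rangle\langle\Omega|$, if and only if $\psi_0(\tau_t(x)\tau_t(y))\to\psi_0(x)\psi_0(y)$ as $t\to\infty$ for all $x,y\in\mathcal{A}_0$.
   Context: Time $t\ge 0$ is in $\mathbb{R}_+$ or $\mathbb{Z}_+$, and $\mathbb{T}$ is $\mathbb{R}$ or $\mathbb{Z}$ correspondingly. Let $\mathcal{B}_{-\infty}$ be the $C^*$-inductive limit of $\mathcal{B}_0\xrightarrow{\lambda_t}\mathcal{B}_0\xrightarrow{\lambda_t}\cdots$: a $C^*$-algebra with a group of automorphisms $(\lambda_t)_{t\in\mathbb{T}}$, an isomorphism $i_0$ of $\mathcal{B}_0$ onto a subalgebra $\mathcal{B}_{[0}$ with $\lambda_t\circ i_0=i_0\circ\lambda_t$ for $t\ge0$, and subalgebras $\mathcal{B}_{[t}=\lambda_t(\mathcal{B}_{[0})$, $t\in\mathbb{T}$, decreasing in $t$ and with $\bigcup_t\mathcal{B}_{[t}$ norm dense. $\psi_{-\infty}$ is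 the unique $(\lambda_t)$-invariant state of $\mathcal{B}_{-\infty}$ with $\psi_{-\infty}\circ i_0=\psi$, and $(\mathcal{H}_\pi,\pi,\Omega)$ is its GNS triple. The projections $F_{t]}$ decrease as $t\to-\infty$. Let $\pi_0$ be the GNS representation of $(\mathcal{B}_0,\psi)$; $(\lambda_t)_{t\ge 0}$ also denotes the normal extension to endomorphisms of $\pi_0(\mathcal{B}_0)''$, and $\psi$ the GNS vector state on $\pi_0(\mathcal{B}_0)''$. $P$ is the support projection of $\psi$ in $\pi_0(\mathcal{B}_0)''$, $\mathcal{A}_0=P\pi_0(\mathcal{B}_0)''P$, $\tau_t(x)=P\lambda_t(PxP)P$ and $\psi_0(x)=\psi(PxP)$ for $x\in\mathcal{A}_0$, $t\ge0$. *)

(* Defs.v *)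
From HB Require Import structures.
From mathcomp Require Import all_boot all_order all_algebra.
From mathcomp Require Import complex.
From mathcomp Require Import all_classical all_reals all_analysis.

Set Implicit Arguments.
Unset Strict Implicit.
Unset Printing Implicit Defensive.

Import Order.TTheory GRing.Theory Num.Theory.
Import numFieldNormedType.Exports.

Local Open Scope classical_set_scope.
Local Open Scope ring_scope.

(* The complex numbers, seen through [numClosedFieldType] so that the norm
   topology of MathComp-Analysis is found. *)
Definition Cplx (R : realType) : numClosedFieldType := R[i].

(** * Time *)

Inductive time_kind := continuous_time | discrete_time.

Definition time (R : realType) (k : time_kind) : realDomainType :=
  match k with
  | continuous_time => (R : realDomainType)
  | discrete_time => (int : realDomainType)
  end.

Definition to_pinfty (T : realDomainType) : set_system T :=
  [set A | exists s, forall t, s <= t -> A t].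

Definition to_minfty (T : realDomainType) : set_system T :=
  [set A | exists s, forall t, t <= s -> A t].

Arguments to_pinfty T : clear implicits.
Arguments to_minfty T : clear implicits.

(** * Hilbert spaces *)

(* The inner product is linear in its second argument. *)
HB.mixin Record CompleteNormedModule_isHilbert (R : realType) H
    of CompleteNormedModule (Cplx R) H := {
  inner : H -> H -> Cplx R ;
  inner_linearr : forall xi, scalar (inner xi) ;
  inner_conj : forall xi eta, inner xi eta = (inner eta xi)^* ;
  inner_norm : forall xi, inner xi xi = `|xi| ^+ 2
}.

#[short(type="hilbertType")]
HB.structure Definition Hilbert (R : realType) :=
  { H of CompleteNormedModule (Cplx R) H & CompleteNormedModule_isHilbert R H }.

Section Operators.
Context {R : realType} {H : hilbertType R}.
Implicit Types (x y p q : H -> H) (S M : set (H -> H)).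

Definition bounded_operator x :=
  linear x /\ exists K : Cplx R, forall xi, `|x xi| <= K * `|xi|.

Definition adjoint x y := forall xi eta, inner (x xi) eta = inner xi (y eta).

Definition projection p :=
  [/\ bounded_operator p, p \o p = p & adjoint p p].

Definition commutant S : set (H -> H) :=
  [set y | bounded_operator y /\ forall x, S x -> x \o y = y \o x].

Definition bicommutant S := commutant (commutant S).

Definition vector_functional (Omega : H) x : Cplx R := inner Omega (x Omega).

(* The rank-one operator |xi><eta|. *)
Definition ket_bra (xi eta : H) : H -> H := fun zeta => inner eta zeta *: xi.

(* The smallest projection [p] of [M] such that [phi (1 - p) = 0]. *)
Definition support_projection M (phi : (H -> H) -> Cplx R) p :=
  [/\ projection p, M p, phi p = phi idfun &
      forall q, projection q -> M q -> phi q = phi idfun -> q \o p = p].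

Definition square_summable (xi : nat -> H) :=
  cvgn (series (fun n => `|xi n| ^+ 2 : Cplx R)).

(* The functionals that define the sigma-weak topology of B(H). *)
Definition sigma_weak_functional (xi eta : nat -> H) x : Cplx R :=
  limn (series (fun n => inner (xi n) (x (eta n)))).

Definition sigma_weak_cvg (F : set_system (H -> H)) x :=
  forall xi eta, square_summable xi -> square_summable eta ->
    sigma_weak_functional xi eta @ F --> sigma_weak_functional xi eta x.

(* [Phi] is continuous on [M] for the sigma-weak topology. *)
Definition normal_map M (Phi : (H -> H) -> (H -> H)) :=
  forall (F : set_system (H -> H)) x, ProperFilter F -> F M -> M x ->
    sigma_weak_cvg F x -> sigma_weak_cvg (Phi @ F) (Phi x).

(* *-endomorphisms of [M]; they need not fix the identity. *)
Definition operator_endomorphism M (Phi : (H -> H) -> (H -> H)) :=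
  [/\ forall x, M x -> M (Phi x),
      forall (a : Cplx R) x y, M x -> M y ->
        Phi (a *: x + y) = a *: Phi x + Phi y,
      forall x y, M x -> M y -> Phi (x \o y) = Phi x \o Phi y &
      forall x y, M x -> M y -> adjoint x y -> adjoint (Phi x) (Phi y)].

End Operators.

(** * C*-algebras *)

(* No unit is assumed. *)
HB.mixin Record CompleteNormedModule_isCStarAlgebra (R : realType) A
    of CompleteNormedModule (Cplx R) A := {
  cmul : A -> A -> A ;
  star : A -> A ;
  cmulA : associative cmul ;
  cmul_linearl : forall b, linear (cmul^~ b) ;
  cmul_linearr : forall a, linear (cmul a) ;
  starK : involutive star ;
  star_semilinear : forall (c : Cplx R) a b,
    star (c *: a + b) = c^* *: star a + star b ;
  starM : forall a b, star (cmul a b) = cmul (star b) (star a) ;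
  cmul_norm : forall a b, `|cmul a b| <= `|a| * `|b| ;
  cstar_identity : forall a, `|cmul (star a) a| = `|a| ^+ 2
}.

#[short(type="cstarType")]
HB.structure Definition CStarAlgebra (R : realType) :=
  { A of CompleteNormedModule (Cplx R) A
       & CompleteNormedModule_isCStarAlgebra R A }.

Definition star_hom (R : realType) (A B : cstarType R) (f : A -> B) :=
  [/\ linear f, {morph f : a b / cmul a b} & {morph f : a / star a}].

(* Positive linear functionals of norm one. *)
Definition state (R : realType) (A : cstarType R) (phi : A -> Cplx R) :=
  [/\ scalar phi,
      forall a, 0 <= phi (cmul (star a) a),
      forall a, `|phi a| <= `|a| &
      forall e : Cplx R, 0 < e -> exists2 a, `|a| <= 1 & 1 - e < `|phi a|].

Definition representation (R : realType) (A : cstarType R)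
    (H : hilbertType R) (pi : A -> H -> H) :=
  [/\ forall a, bounded_operator (pi a),
      forall (c : Cplx R) a b, pi (c *: a + b) = c *: pi a + pi b,
      forall a b, pi (cmul a b) = pi a \o pi b &
      forall a, adjoint (pi a) (pi (star a))].

Definition gns_triple (R : realType) (A : cstarType R) (phi : A -> Cplx R)
    (H : hilbertType R) (pi : A -> H -> H) (Omega : H) :=
  [/\ representation pi,
      closure [set pi a Omega | a in [set: A]] = [set: H] &
      forall a, phi a = vector_functional Omega (pi a)].

(** * Dynamics *)

Section Dynamics.
Context {R : realType} {T : realDomainType}.

Definition injective_endomorphism_semigroup (B : cstarType R)
    (lam : T -> B -> B) :=
  [/\ forall t, 0 <= t -> star_hom (lam t),
      forall t, 0 <= t -> injective (lam t),
      lam 0 = idfun &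
      forall s t, 0 <= s -> 0 <= t -> lam (s + t) = lam s \o lam t].

Definition automorphism_group (B : cstarType R) (alpha : T -> B -> B) :=
  [/\ forall t, star_hom (alpha t),
      alpha 0 = idfun &
      forall s t, alpha (s + t) = alpha s \o alpha t].

(* The subalgebra B_[t. *)
Definition tail_algebra (B0 B : cstarType R) (alpha : T -> B -> B)
    (i0 : B0 -> B) (t : T) : set B :=
  alpha t @` range i0.

(* [alpha t \o i0 : B0 -> B] is the embedding of the copy of [B0] at time [t];
   the copies at times [s <= t] are linked by the connecting map [lam (t - s)],
   and the limit is the completion of the union of the copies. *)
Definition inductive_limit (B0 B : cstarType R) (lam : T -> B0 -> B0)
    (alpha : T -> B -> B) (i0 : B0 -> B) :=
  [/\ automorphism_group alpha,
      star_hom i0 /\ injective i0,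
      forall t, 0 <= t -> alpha t \o i0 = i0 \o lam t &
      closure (\bigcup_t tail_algebra alpha i0 t) = [set: B]].

Lemma tail_algebra_decreasing (B0 B : cstarType R) (lam : T -> B0 -> B0)
    (alpha : T -> B -> B) (i0 : B0 -> B) (s t : T) :
  inductive_limit lam alpha i0 -> s <= t ->
  tail_algebra alpha i0 t `<=` tail_algebra alpha i0 s.
Proof.
move=> [[_ _ alphaD] _ comm _] le_st _ [_ [b _ <-] <-].
exists (i0 (lam (t - s) b)); first by exists (lam (t - s) b).
rewrite -[i0 (lam _ _)]/((i0 \o lam (t - s)) b) -comm ?subr_ge0//.
by rewrite -[LHS]/((alpha s \o alpha (t - s)) (i0 b)) -alphaD addrC subrK.
Qed.

Definition invariant_on (B : Type) (D : set T) (lam : T -> B -> B)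
    (phi : B -> Cplx R) :=
  forall t, D t -> phi \o lam t = phi.

End Dynamics.

(** * Reduction to the support projection *)

Section Reduction.
Context {R : realType} {T : realDomainType} {H : hilbertType R}.
Implicit Types (P x : H -> H).

(* The corner P M P. *)
Definition reduced_algebra (M : set (H -> H)) P : set (H -> H) :=
  [set P \o m \o P | m in M].

Definition reduced_semigroup (Lam : T -> (H -> H) -> (H -> H)) P (t : T) x :=
  P \o Lam t (P \o x \o P) \o P.

Definition reduced_state (phi : (H -> H) -> Cplx R) P x := phi (P \o x \o P).

End Reduction.

(* Main.v *)
(* For every time [t] the GNS space of [psi] embeds in that of [psi_{-oo}] by an
   isometry [V_t] with [V_t (pi0 b Omega0) = pi (alpha_t (i0 b)) Omega]. It sends
   [Omega0] to [Omega], and it satisfies [V_t P = F_t V_t], because [P] and [F_t]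
   are the projections onto the closures of the commutant orbits of the two
   vectors. Moreover [V_{s-t} (Lam_t m Omega0) = V_s (m Omega0)] for all [m] in the
   von Neumann algebra: this is clear on [pi0 B0], and it extends because
   [psi o Lam_t = psi], by normality and sigma-weak density. Hence, for
   [x], [y] in [A0] and every [s],
     [psi0 (tau_t x tau_t y) = <V_s x* Omega0, F_{s-t} V_s y Omega0>],
   which tends to [<V_s x* Omega0, Q V_s y Omega0>] as [t -> +oo]. Since
   [Q = F_s Q = Q F_s] and the ranges of the [V_s] increase to the whole space
   as [s -> -oo], these matrix elements determine [Q]. *)

Require Import Defs.
From HB Require Import structures.
From mathcomp Require Import all_boot all_order all_algebra.
From mathcomp Require Import complex.
From mathcomp Require Import all_classical all_reals all_analysis.
From mathcomp Require Import ring lra.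

Set Implicit Arguments.
Unset Strict Implicit.
Unset Printing Implicit Defensive.

Import Order.TTheory GRing.Theory Num.Theory.
Import numFieldNormedType.Exports.

Local Open Scope classical_set_scope.
Local Open Scope ring_scope.

(** * Squared norms and the projection theorem *)

(* Norms take their values in [Cplx R]; [csq] and [sqn] are squared norms with
   values in the ordered field [R]. *)

(** [B0] has no unit, so [Omega0] need not have the form [pi0 b Omega0], and [V_t Omega0 = Omega]
    does not come with the construction of [V_t]. It follows from the equality of the norms of the
    two vectors, which is obtained by duality from the density of their orbits. The invariance of
    the vector state under [Lam_t] is given only on [pi0 B0]. Normality being stated for filters,
    its extension needs, for each [m] in the bicommutant, a proper filter on [pi0 B0] that converges
    to [m] sigma-weakly. Hence the passage to l2(H), where approximation on a whole square-summable
    sequence becomes approximation on a single vector. The projection theorem is therefore proved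
    for an abstract semi-inner product, which serves both [H] and l2(H). Estimates compare real
    squared norms, and |x + y|^2 <= 2|x|^2 + 2|y|^2 replaces the triangle inequality; most constants
    2 and 4 come from there. *)

Section ComplexNumbers.
Context {R : realType}.
Implicit Types (c d : Cplx R) (t : R).

Definition re c : R := complex.Re c.
Definition im c : R := complex.Im c.
Definition ofR t : Cplx R := real_complex R t.
Definition csq c : R := re c ^+ 2 + im c ^+ 2.

Lemma reD c d : re (c + d) = re c + re d. Proof. by case: c d => [? ?] [? ?]. Qed.
Lemma imD c d : im (c + d) = im c + im d. Proof. by case: c d => [? ?] [? ?]. Qed.
Lemma reN c : re (- c) = - re c. Proof. by case: c. Qed.
Lemma imN c : im (- c) = - im c. Proof. by case: c. Qed.
Lemma reM c d : re (c * d) = re c * re d - im c * im d.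
Proof. by case: c d => [? ?] [? ?]. Qed.
Lemma imM c d : im (c * d) = re c * im d + im c * re d.
Proof. by case: c d => [? ?] [? ?]. Qed.
Lemma re_conj c : re c^* = re c. Proof. by case: c. Qed.
Lemma im_conj c : im c^* = - im c. Proof. by case: c. Qed.
Lemma re_ofR t : re (ofR t) = t. Proof. by []. Qed.
Lemma im_ofR t : im (ofR t) = 0. Proof. by []. Qed.

Definition reimE := (reD, imD, reN, imN, reM, imM, re_conj, im_conj, re_ofR, im_ofR).

Lemma cplxP c d : re c = re d -> im c = im d -> c = d.
Proof. by case: c d => [? ?] [? ?]; rewrite /re /im /= => -> ->. Qed.

Lemma csq_ge0 c : 0 <= csq c. Proof. by rewrite addr_ge0 ?sqr_ge0. Qed.

Lemma csq_eq0 c : csq c = 0 -> c = 0.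
Proof.
move=> /eqP; rewrite paddr_eq0 ?sqr_ge0// !sqrf_eq0 => /andP[/eqP ? /eqP ?].
exact: cplxP.
Qed.

Lemma csqD_le c d : csq (c + d) <= 2 * csq c + 2 * csq d.
Proof.
rewrite /csq !reimE.
have := sqr_ge0 (re c - re d); have := sqr_ge0 (im c - im d).
lra.
Qed.

Lemma csqN c : csq (- c) = csq c.
Proof. by rewrite /csq !reimE !sqrrN. Qed.

Lemma csqM c d : csq (c * d) = csq c * csq d.
Proof. by rewrite /csq !reimE; ring. Qed.

Lemma cnorm2 c : `|c| ^+ 2 = ofR (csq c).
Proof. by rewrite /csq /ofR add_Re2_Im2. Qed.

Lemma ofR_lt (s t : R) : (ofR s < ofR t) = (s < t). Proof. exact: ltcR. Qed.
Lemma ofR_le (s t : R) : (ofR s <= ofR t) = (s <= t). Proof. exact: lecR. Qed.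
Lemma ofRM (s t : R) : ofR (s * t) = ofR s * ofR t. Proof. exact: rmorphM. Qed.
Lemma ofRX (s : R) n : ofR (s ^+ n) = ofR s ^+ n. Proof. exact: rmorphXn. Qed.

Lemma ofR_re c : 0 <= c -> c = ofR (re c).
Proof. by move=> /ger0_real /RRe_real. Qed.

(** Most limit arguments below end with this lemma: a squared distance is bounded by a fixed
    multiple of every positive [e]. *)
Lemma eq0_small (a C : R) : 0 <= a -> (forall e : R, 0 < e -> a <= C * e) -> a = 0.
Proof.
move=> a_ge0 small; apply/eqP; rewrite eq_le a_ge0 andbT.
apply/ler_addgt0Pr => e e_gt0; rewrite add0r.
(* [C] may be zero or negative; this divisor is positive and still dominates it. *)
have C1 : 0 < `|C| + 1 by rewrite ltr_wpDl.
apply: (le_trans (small (e / (`|C| + 1)) _)); first exact: divr_gt0.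
rewrite mulrA ler_pdivrMr// mulrC ler_pM2l//.
by apply: (le_trans (ler_norm _)); rewrite lerDl.
Qed.

Lemma small_sequence : exists2 r : nat -> R, forall n, 0 < r n &
  forall e : R, 0 < e -> exists N, forall n, (N <= n)%N -> r n < e.
Proof.
exists (fun n => n.+1%:R^-1) => [n|e e0]; first by rewrite invr_gt0.
exists (Num.truncn e^-1) => n len; rewrite invf_plt ?posrE//.
by apply: (lt_le_trans (truncnS_gt _)); rewrite ler_nat.
Qed.

End ComplexNumbers.

(** * Semi-inner products: Cauchy-Schwarz and orthogonal projections *)

Section SemiInnerProduct.
Context {R : realType} {E : lmodType (Cplx R)} (ip : E -> E -> Cplx R).

(** Kept as a predicate on a form over a bare module, so that it applies to l2(H), which receives no
    norm. For the same reason [adherent] and [sqn_complete] express closure and completeness through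
    [sqn] alone. *)
Definition semi_inner_product :=
  [/\ forall x, scalar (ip x), forall x y, ip x y = (ip y x)^* &
      forall x, 0 <= ip x x].

Definition sqn x : R := re (ip x x).

Definition adherent (K : set E) x :=
  forall e : R, 0 < e -> exists2 k, K k & sqn (x - k) < e.

Definition lin_subset (K : set E) :=
  K 0 /\ forall (a : Cplx R) x y, K x -> K y -> K (a *: x + y).

Definition sqn_complete := forall u : nat -> E,
  (forall e : R, 0 < e -> exists N, forall m n, (N <= m)%N -> (N <= n)%N ->
     sqn (u m - u n) < e) ->
  exists z, forall e : R, 0 < e -> exists N, forall n, (N <= n)%N ->
     sqn (u n - z) < e.

Hypothesis ipP : semi_inner_product.

Let ip_lin x : scalar (ip x). Proof. by case: ipP. Qed.
Lemma ipC x y : ip x y = (ip y x)^*. Proof. by case: ipP. Qed.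
Lemma ipDr x y z : ip x (y + z) = ip x y + ip x z.
Proof. by have := ip_lin x 1 y z; rewrite scale1r mul1r. Qed.
Lemma ip0r x : ip x 0 = 0.
Proof. by apply: (addIr (ip x 0)); rewrite -ipDr addr0 add0r. Qed.
Lemma ipZr x (a : Cplx R) y : ip x (a *: y) = a * ip x y.
Proof. by have := ip_lin x a y 0; rewrite !addr0 ip0r addr0. Qed.
Lemma ipNr x y : ip x (- y) = - ip x y.
Proof. by rewrite -scaleN1r ipZr mulN1r. Qed.
Lemma ipDl x y z : ip (x + y) z = ip x z + ip y z.
Proof. by rewrite ipC ipDr rmorphD /= -!ipC. Qed.
Lemma ipZl (a : Cplx R) x y : ip (a *: x) y = a^* * ip x y.
Proof. by rewrite ipC ipZr rmorphM /= -!ipC. Qed.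
Lemma ip0l x : ip 0 x = 0. Proof. by rewrite ipC ip0r rmorph0. Qed.
Lemma ipNl x y : ip (- x) y = - ip x y.
Proof. by rewrite ipC ipNr rmorphN /= -ipC. Qed.

Definition ipE := (ipDr, ipDl, ipNr, ipNl, ipZr, ipZl, ip0l, ip0r).

Lemma sqn_ge0 x : 0 <= sqn x.
Proof. by case: ipP => _ _ /(_ x); rewrite lecE => /andP[]. Qed.

Lemma ip_sqn x : ip x x = ofR (sqn x).
Proof. by apply: ofR_re; case: ipP. Qed.

Lemma sqnN x : sqn (- x) = sqn x.
Proof. by rewrite /sqn !ipE opprK. Qed.

Lemma sqnBC x y : sqn (x - y) = sqn (y - x).
Proof. by rewrite -sqnN opprB. Qed.

Lemma sqn0 : sqn 0 = 0. Proof. by rewrite /sqn ip0l. Qed.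

Lemma sqnD x y : sqn (x + y) = sqn x + sqn y + 2 * re (ip x y).
Proof. by rewrite /sqn !ipE [ip y x]ipC !reimE; lra. Qed.

Lemma sqnZ (a : Cplx R) x : sqn (a *: x) = csq a * sqn x.
Proof. by rewrite /sqn !ipE ip_sqn /csq !reimE; lra. Qed.

Lemma sqnD_le x y : sqn (x + y) <= 2 * sqn x + 2 * sqn y.
Proof.
have := sqn_ge0 (x - y); rewrite !sqnD sqnN !ipE reN; lra.
Qed.

Lemma parallelogram x y : sqn (x + y) + sqn (x - y) = 2 * sqn x + 2 * sqn y.
Proof. by rewrite !sqnD sqnN !ipE reN; lra. Qed.

(** Minimise over the multiples [a = t * ip x y] with [t] real. With [d = 0] this is Cauchy-Schwarz;
    with [d] the squared distance from a point to a subspace containing [x], it says that a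
    near-minimiser leaves a residual [y] nearly orthogonal to [x]. *)
Lemma csq_ip_le x y (d : R) :
  (forall a : Cplx R, d <= sqn (y - a *: x)) ->
  csq (ip x y) <= sqn x * (sqn y - d).
Proof.
move=> le_d; set c := ip x y.
have dy : d <= sqn y by have := le_d 0; rewrite scale0r subr0.
have var t : d <= sqn y - 2 * t * csq c + t ^+ 2 * csq c * sqn x.
  have := le_d (ofR t * c).
  rewrite sqnD sqnN sqnZ !ipE [ip y x]ipC -/c /csq !reimE.
  by congr (_ <= _); ring.
have [x0|x_neq0] := eqVneq (sqn x) 0.
  rewrite x0 mul0r leNgt; apply/negP => c_gt0.
  (* When [sqn x = 0] the lower bound is affine in [t] with slope [- 2 * csq c]; this [t] is large
     enough to violate it. *)
  have := var ((sqn y - d + 1) / csq c).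
  rewrite x0 mulr0 addr0 mulrA divfK ?gt_eqF//; lra.
have x_gt0 : 0 < sqn x by rewrite lt_def x_neq0 sqn_ge0.
have := var (sqn x)^-1.
rewrite expr2 -[X in _ + X]mulrA [csq c * _]mulrC mulrA mulfVK// => h.
rewrite -ler_pdivrMl//; lra.
Qed.

Lemma cauchy_schwarz x y : csq (ip x y) <= sqn x * sqn y.
Proof.
by rewrite -[sqn y]subr0; apply: csq_ip_le => a; exact: sqn_ge0.
Qed.

Lemma orthogonal_adherent (K : set E) x y :
  (forall k, K k -> ip k y = 0) -> adherent K x -> ip x y = 0.
Proof.
move=> Ky xK; apply: csq_eq0; apply: (@eq0_small _ _ (sqn y)); first exact: csq_ge0.
move=> e /xK[k Kk /ltW xk].
have -> : ip x y = ip (x - k) y by rewrite ipDl ipNl (Ky k)// subr0.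
apply: (le_trans (cauchy_schwarz _ _)); rewrite mulrC ler_wpM2l//.
exact: sqn_ge0.
Qed.

Lemma adherent_in (K : set E) x : K x -> adherent K x.
Proof. by move=> Kx e e0; exists x => //; rewrite subrr sqn0. Qed.

Lemma adherent_idem (K : set E) x : adherent (adherent K) x -> adherent K x.
Proof.
move=> xK e e0; have e4 : 0 < e / 4 by lra.
have [k /(_ _ e4)[l Kl kl] xk] := xK _ e4.
exists l => //; rewrite -(subrKA k).
by apply: (le_lt_trans (sqnD_le _ _)); lra.
Qed.

Lemma adherent_lin (K : set E) : lin_subset K -> lin_subset (adherent K).
Proof.
move=> [K0 Klin]; split; first exact: adherent_in.
move=> a x y xK yK e e0.
have d0 : 0 < e / (2 * csq a + 2).
  by apply: divr_gt0 => //; have := csq_ge0 a; lra.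
have [k Kk xk] := xK _ d0; have [l Kl yl] := yK _ d0.
exists (a *: k + l); first exact: Klin.
rewrite opprD addrACA -scalerBr.
apply: (le_lt_trans (sqnD_le _ _)); rewrite sqnZ.
have -> : e = 2 * (csq a * (e / (2 * csq a + 2))) + 2 * (e / (2 * csq a + 2)).
  by field; have := csq_ge0 a; lra.
rewrite ler_ltD// ?ler_wpM2l ?csq_ge0//; last by rewrite ltr_pM2l.
exact: ltW.
Qed.

Lemma adherent_orthogonal_sqn0 (K : set E) x : lin_subset K ->
  adherent K x -> (forall k, K k -> ip k x = 0) -> sqn x = 0.
Proof.
by move=> Klin xK xo; rewrite /sqn (orthogonal_adherent xo xK).
Qed.

(** The limit of a minimising sequence. As [K] is not assumed closed, the foot [z] is only adherent
    to it; orthogonality passes to the limit from the near-orthogonality [u_var] of the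
    minimisers. *)
Lemma projection_theorem (K : set E) : sqn_complete -> lin_subset K ->
  forall x, exists2 z, adherent K z & forall k, K k -> ip k (x - z) = 0.
Proof.
move=> complete [K0 Klin] x.
have [r r_gt0 r_small] := @small_sequence R.
pose S := [set sqn (x - k) | k in K]; pose d : R := inf S.
have Slb : has_lbound S by exists 0 => _ [k _ <-]; exact: sqn_ge0.
have Sinf : has_inf S by split=> //; exists (sqn (x - 0)); exists 0.
have le_d k : K k -> d <= sqn (x - k) by move=> Kk; apply: ge_inf => //; exists k.
have /choice[u uP] : forall n, exists k, K k /\ sqn (x - k) < d + r n.
  by move=> n; have [_ [k Kk <-] lt_k] := inf_adherent (r_gt0 n) Sinf; exists k.
have u_var n k : K k -> csq (ip k (x - u n)) <= sqn k * r n.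
  move=> Kk; apply: (le_trans (@csq_ip_le k (x - u n) d _)).
    move=> a; rewrite -addrA -opprD; apply: le_d; rewrite addrC.
    by apply: Klin => //; case: (uP n).
  rewrite ler_wpM2l ?sqn_ge0//; have [_] := uP n; lra.
have u_cauchy m n : sqn (u m - u n) <= 2 * r m + 2 * r n.
  have := parallelogram (x - u m) (x - u n).
  have -> : x - u m - (x - u n) = - (u m - u n).
    by rewrite !opprB addrC addrA subrK.
  rewrite sqnN.
  (* The midpoint of [u m] and [u n] lies in [K], hence at squared distance at least [d] from [x].
     In the parallelogram law the terms in [d] cancel and only the errors [r m] and [r n] remain. *)
  have -> : x - u m + (x - u n) = ofR 2 *: (x - ofR (2^-1) *: (u m + u n)).
    rewrite scalerBr scalerA -ofRM mulfV ?pnatr_eq0// scale1r.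
    have -> : ofR 2 = 2%:R :> Cplx R by rewrite /ofR rmorph_nat.
    by rewrite scaler_nat mulr2n opprD addrACA.
  have : d <= sqn (x - ofR 2^-1 *: (u m + u n)).
    have Ku i : K (u i) by case: (uP i).
    apply: le_d; rewrite scalerDr; apply: (Klin _ _ _ (Ku m)).
    by rewrite -[_ *: u n]addr0; exact: (Klin _ _ _ (Ku n) K0).
  rewrite sqnZ /csq !reimE.
  have [_] := uP m; have [_] := uP n; lra.
have [|z zP] := complete u.
  move=> e e0; have [|N NP] := r_small (e / 4); first by lra.
  exists N => m n Nm Nn; have := u_cauchy m n; have := NP _ Nm; have := NP _ Nn.
  lra.
exists z.
  move=> e /zP[N /(_ N (leqnn _)) uz]; exists (u N); first by case: (uP N).
  by rewrite sqnBC.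
move=> k Kk; apply: csq_eq0; apply: (@eq0_small _ _ (4 * sqn k)); first exact: csq_ge0.
move=> e e0; have [N1 N1P] := zP _ e0; have [N2 N2P] := r_small _ e0.
have {N1P} := N1P _ (leq_maxl N1 N2); have {N2P} := N2P _ (leq_maxr N1 N2).
set n := maxn N1 N2 => n_e un_e.
have -> : ip k (x - z) = ip k (x - u n) + ip k (u n - z) by rewrite -ipDr subrKA.
have h1 := u_var n k Kk.
have h2 := cauchy_schwarz k (u n - z).
have h3 : sqn k * r n <= sqn k * e by rewrite ler_wpM2l ?sqn_ge0// ltW.
have h4 : sqn k * sqn (u n - z) <= sqn k * e by rewrite ler_wpM2l ?sqn_ge0// ltW.
have := csqD_le (ip k (x - u n)) (ip k (u n - z)); lra.
Qed.

(** Definiteness makes the foot unique. The uniqueness clause yields linearity, and it is exported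
    because later identities [p v = w] are proved by checking that [w] is adherent and [v - w]
    orthogonal. *)
Lemma projection_exists (K : set E) : sqn_complete ->
  (forall x, sqn x = 0 -> x = 0) -> lin_subset K -> exists p : E -> E,
  [/\ linear p, forall v, sqn (p v) <= sqn v,
      forall v w, ip (p v) w = ip v (p w), forall v, adherent K (p v) &
      (forall v k, K k -> ip k (v - p v) = 0) /\
      (forall v w, adherent K w -> (forall k, K k -> ip k (v - w) = 0) -> p v = w)].
Proof.
move=> complete definite KL; have Kadh := adherent_lin KL.
have /choice[p pP] : forall v, exists w,
    adherent K w /\ forall k, K k -> ip k (v - w) = 0.
  by move=> v; have [w ? ?] := projection_theorem complete KL v; exists w.
have p_adh v : adherent K (p v) by case: (pP v).
have p_orth v w : adherent K w -> ip w (v - p v) = 0.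
  by have [_ h] := pP v; exact: orthogonal_adherent h.
have p_uniq v w : adherent K w ->
    (forall k, K k -> ip k (v - w) = 0) -> p v = w.
  move=> wK vw; apply/eqP; rewrite -subr_eq0; apply/eqP/definite.
  apply: (adherent_orthogonal_sqn0 KL).
    by have := Kadh.2 (-1) _ _ wK (p_adh v); rewrite scaleN1r addrC.
  move=> k Kk; rewrite -(subrKA v) addrC ipDr vw// add0r.
  by rewrite -opprB ipNr p_orth ?oppr0//; exact: adherent_in.
have pA v w : ip (p v) w = ip v (p w).
  have := p_orth w _ (p_adh v); have := p_orth v _ (p_adh w).
  move=> /(congr1 Num.conj); rewrite -ipC rmorph0 ipDl ipNl => h2.
  rewrite ipDr ipNr => /eqP; rewrite subr_eq0 => /eqP ->.
  by move: h2 => /eqP; rewrite subr_eq0 => /eqP ->.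
exists p; split => //; last first.
  by split => // v k Kk; case: (pP v) => _; exact.
- move=> v.
  have := sqn_ge0 (v - p v); have := p_orth v _ (p_adh v).
  rewrite ipDr ipNr => /eqP; rewrite subr_eq0 => /eqP pv.
  rewrite sqnD sqnN ipNr [ip v _]ipC pv !reimE /sqn; lra.
- move=> a u v; apply: p_uniq; first exact: Kadh.2.
  move=> k Kk; rewrite opprD addrACA -scalerBr ipDr ipZr !p_orth ?mulr0 ?addr0//;
    exact: adherent_in.
Qed.

End SemiInnerProduct.

(** * Squared norms and the norm topology *)

Section SquaredNorm.
Context {R : realType} {V : normedModType (Cplx R)} (s : V -> R).
Hypothesis sE : forall x, `|x| ^+ 2 = ofR (s x).

Lemma sqnorm_lt x (e : R) : 0 <= e -> (`|x| < ofR e) = (s x < e ^+ 2).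
Proof.
by move=> e0; rewrite -ofR_lt -sE ofRX ltr_pXn2r// nnegrE// (ofR_le 0).
Qed.

Lemma ofR_pos (e : Cplx R) : 0 < e -> exists2 r : R, 0 < r & e = ofR r.
Proof.
move=> e0; exists (re e); last exact/ofR_re/ltW.
by rewrite -ofR_lt -ofR_re// ltW.
Qed.

Lemma cvg_sqnormP (T : Type) (F : set_system T) (FF : Filter F) (f : T -> V) l :
  f @ F --> l <-> forall e : R, 0 < e -> \forall t \near F, s (f t - l) < e.
Proof.
split=> [/cvgrPdist_lt fl e e0|fl].
  have : 0 < ofR (Num.sqrt e) by rewrite (ofR_lt 0) sqrtr_gt0.
  move=> /fl; apply: filterS => t; rewrite distrC sqnorm_lt ?sqrtr_ge0//.
  by rewrite sqr_sqrtr// ltW.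
apply/cvgrPdist_lt => _ /ofR_pos[e e0 ->].
have e2 : 0 < e ^+ 2 by rewrite exprn_gt0.
by apply: filterS (fl _ e2) => t; rewrite distrC sqnorm_lt// ltW.
Qed.

Lemma closure_sqnormP (K : set V) x :
  closure K x <-> forall e : R, 0 < e -> exists2 k, K k & s (x - k) < e.
Proof.
split=> [xK e e0|xK B /nbhs_normP[_ /= /ofR_pos[e e0 ->]] sB].
  have se : 0 < ofR (Num.sqrt e) by rewrite (ofR_lt 0) sqrtr_gt0.
  have [|k [Kk]] := xK (ball x (ofR (Num.sqrt e))); first exact: nbhsx_ballx.
  rewrite -ball_normE /= sqnorm_lt ?sqrtr_ge0// sqr_sqrtr ?ltW// => ?.
  by exists k.
have e2 : 0 < e ^+ 2 by rewrite exprn_gt0.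
have [k Kk xk] := xK _ e2; exists k; split => //; apply: sB.
by rewrite /= sqnorm_lt// ltW.
Qed.

End SquaredNorm.

Section HilbertSpaces.
Context {R : realType}.

Lemma inner_sip (H : hilbertType R) : semi_inner_product (@inner R H).
Proof.
split=> [x|x y|x]; [exact: inner_linearr|exact: inner_conj|].
by rewrite inner_norm exprn_ge0.
Qed.

Definition sq (H : hilbertType R) : H -> R := sqn (@inner R H).

Lemma norm_sq (H : hilbertType R) (x : H) : `|x| ^+ 2 = ofR (sq x).
Proof. by rewrite -inner_norm (ip_sqn (inner_sip H)). Qed.

Lemma sq_ge0 (H : hilbertType R) (x : H) : 0 <= sq x.
Proof. exact: sqn_ge0 (inner_sip H) x. Qed.

Lemma sq_eq0 (H : hilbertType R) (x : H) : sq x = 0 -> x = 0.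
Proof.
move=> x0; apply/eqP; rewrite -normr_eq0 -sqrf_eq0 norm_sq x0.
exact/eqP/cplxP.
Qed.

Lemma cvg_sqP (H : hilbertType R) (T : Type) (F : set_system T) :
  Filter F -> forall (f : T -> H) l,
  f @ F --> l <-> forall e : R, 0 < e -> \forall t \near F, sq (f t - l) < e.
Proof. by move=> FF f l; apply: cvg_sqnormP; exact: norm_sq. Qed.

Lemma ccvg_sqP (T : Type) (F : set_system T) :
  Filter F -> forall (f : T -> Cplx R) l,
  f @ F --> l <-> forall e : R, 0 < e -> \forall t \near F, csq (f t - l) < e.
Proof. by move=> FF f l; apply: (cvg_sqnormP (V := (Cplx R)^o)); exact: cnorm2. Qed.

Lemma closure_sqP (H : hilbertType R) (K : set H) x :
  closure K x <-> adherent inner K x.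
Proof. by apply: closure_sqnormP; exact: norm_sq. Qed.

Lemma inner_complete (H : hilbertType R) : sqn_complete (@inner R H).
Proof.
move=> u uC; have : cauchy (u @ \oo).
  apply: cauchy_exP => _ /ofR_pos[e e0 ->].
  have [|N NP] := uC (e ^+ 2); first by rewrite exprn_gt0.
  exists (u N); exists N => // n /= Nn; rewrite -ball_normE /=.
  by rewrite (sqnorm_lt (@norm_sq H)) ?ltW// NP.
move=> /cauchy_cvgP /(cvg_sqP (F := \oo)) uz; exists (lim (u @ \oo)) => e /uz[N _ NP].
by exists N.
Qed.

Lemma boundedP (H : hilbertType R) (x : H -> H) : bounded_operator x <->
  linear x /\ exists2 K : R, 0 <= K & forall v, sq (x v) <= K * sq v.
Proof.
split=> -[xl]; [case=> K KP|case=> K K0 KP]; split => //.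
  exists (csq K) => [|v]; first exact: csq_ge0.
  rewrite -ofR_le -norm_sq ofRM -norm_sq -cnorm2 -exprMn.
  have Kv : 0 <= K * `|v| by exact: le_trans (KP v).
  rewrite ler_pXn2r ?nnegrE ?mulr_ge0//.
  by have := KP v; rewrite -{1}(ger0_norm Kv) normrM normr_id.
exists (ofR (Num.sqrt K)) => v.
rewrite -(@ler_pXn2r _ 2)// ?nnegrE ?mulr_ge0 ?(ofR_le 0) ?sqrtr_ge0//.
by rewrite exprMn !norm_sq -ofRX sqr_sqrtr// -ofRM ofR_le.
Qed.

End HilbertSpaces.

Section Linear.
Context {K : pzRingType} {U V : lmodType K} (f : U -> V).
Hypothesis f_lin : linear f.

Lemma lin0 : f 0 = 0.
Proof. by have := f_lin (-1) 0 0; rewrite scaler0 addr0 scaleN1r addNr. Qed.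
Lemma linD x y : f (x + y) = f x + f y.
Proof. by have := f_lin 1 x y; rewrite !scale1r. Qed.
Lemma linZ a x : f (a *: x) = a *: f x.
Proof. by have := f_lin a x 0; rewrite lin0 !addr0. Qed.
Lemma linN x : f (- x) = - f x.
Proof. by rewrite -scaleN1r linZ scaleN1r. Qed.
Lemma linB x y : f (x - y) = f x - f y.
Proof. by rewrite linD linN. Qed.

End Linear.

(** * Riesz representation and adjoints *)

Section BoundedOperators.
Context {R : realType}.
Implicit Types H : hilbertType R.

Lemma innerC H (x y : H) : inner x y = (inner y x)^*.
Proof. exact: ipC (inner_sip H) x y. Qed.
Lemma innerDr H (x y z : H) : inner x (y + z) = inner x y + inner x z.
Proof. exact: ipDr (inner_sip H) x y z. Qed.
Lemma innerDl H (x y z : H) : inner (x + y) z = inner x z + inner y z.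
Proof. exact: ipDl (inner_sip H) x y z. Qed.
Lemma innerZr H (a : Cplx R) (x y : H) : inner x (a *: y) = a * inner x y.
Proof. exact: ipZr (inner_sip H) x a y. Qed.
Lemma innerZl H (a : Cplx R) (x y : H) : inner (a *: x) y = a^* * inner x y.
Proof. exact: ipZl (inner_sip H) a x y. Qed.
Lemma innerNr H (x y : H) : inner x (- y) = - inner x y.
Proof. exact: ipNr (inner_sip H) x y. Qed.
Lemma innerNl H (x y : H) : inner (- x) y = - inner x y.
Proof. exact: ipNl (inner_sip H) x y. Qed.
Lemma inner0r H (x : H) : inner x 0 = 0.
Proof. exact: ip0r (inner_sip H) x. Qed.
Lemma inner0l H (x : H) : inner 0 x = 0.
Proof. exact: ip0l (inner_sip H) x. Qed.

Definition innerE := (innerDr, innerDl, innerNr, innerNl, innerZr, innerZl, inner0l, inner0r).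

Lemma inner_extr H (x y : H) : (forall v, inner v x = inner v y) -> x = y.
Proof.
move=> xy; apply/eqP; rewrite -subr_eq0; apply/eqP/sq_eq0.
by rewrite /sq /sqn innerDr innerNr xy subrr.
Qed.

Lemma sqBC H (x y : H) : sq (x - y) = sq (y - x).
Proof. exact: sqnBC (inner_sip H) x y. Qed.

Lemma sqD_le H (x y : H) : sq (x + y) <= 2 * sq x + 2 * sq y.
Proof. exact: sqnD_le (inner_sip H) x y. Qed.

Lemma sq0 H : sq (0 : H) = 0. Proof. exact: sqn0 (inner_sip H). Qed.

Lemma csq_inner_le H (x y : H) : csq (inner x y) <= sq x * sq y.
Proof. exact: cauchy_schwarz (inner_sip H) x y. Qed.

(** If [f x] is nonzero, the component [u] of [x] orthogonal to the kernel spans its complement: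
    [f u *: v - f v *: u] lies in the kernel, hence is orthogonal to [u], which gives [f v]. *)
Lemma riesz H (f : H -> Cplx R) (K : R) : 0 <= K -> scalar f ->
  (forall v, csq (f v) <= K * sq v) -> exists u, forall v, f v = inner u v.
Proof.
move=> K0 f_lin fK; have [f0|] := pselect (forall v, f v = 0).
  by exists 0 => v; rewrite inner0l f0.
move=> /existsNP[x fx].
have f_lin' : linear (f : H -> (Cplx R)^o) by [].
have kerL : lin_subset [set v | f v = 0].
  split=> [|a u v /= fu fv]; first exact: (lin0 f_lin').
  by rewrite f_lin fu fv mulr0 addr0.
have [z zker xz] := projection_theorem (inner_sip H) (@inner_complete _ H) kerL x.
have fz : f z = 0.
  apply: csq_eq0; apply: (@eq0_small _ _ K); first exact: csq_ge0.
  move=> e /zker[k fk /ltW zk].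
  have -> : f z = f (z - k) by rewrite (linB f_lin') fk subr0.
  apply: (le_trans (fK _)); exact: ler_wpM2l.
pose u := x - z.
have fu : f u = f x by rewrite (linB f_lin') fz subr0.
have u0 : inner u u != 0.
  apply/negP => /eqP uu; apply: fx.
  by rewrite -fu (_ : u = 0) ?(lin0 f_lin')//; apply: sq_eq0; rewrite /sq /sqn uu.
exists ((f u)^* / inner u u *: u) => v.
have : inner u (f u *: v - f v *: u) = 0.
  rewrite innerC xz ?rmorph0//= (linB f_lin') !(linZ f_lin').
  by rewrite /GRing.scale /= mulrC subrr.
rewrite innerDr innerNr !innerZr => /eqP; rewrite addr_eq0 opprK => /eqP fv.
have uu : (inner u u)^* = inner u u by rewrite -innerC.
rewrite innerZl rmorphM /= conjCK fmorphV /= uu mulrAC fv -mulrA divff//.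
by rewrite mulr1.
Qed.

Lemma adjoint_exists_gen (H1 H2 : hilbertType R) (f : H1 -> H2) (K : R) :
  0 <= K -> linear f -> (forall v, sq (f v) <= K * sq v) ->
  exists g : H2 -> H1, [/\ linear g, forall v, sq (g v) <= K * sq v &
    forall x y, inner (f x) y = inner x (g y)].
Proof.
move=> K0 f_lin fK.
have /choice[g gP] : forall y : H2, exists u : H1, forall v, inner y (f v) = inner u v.
  move=> y; apply: (@riesz _ _ (sq y * K)) => [|a u v|v].
  - by rewrite mulr_ge0// sq_ge0.
  - by rewrite f_lin innerDr innerZr.
  - apply: (le_trans (csq_inner_le _ _)); rewrite -mulrA ler_wpM2l//.
    exact: sq_ge0.
have gA x y : inner (f x) y = inner x (g y) by rewrite innerC gP -innerC.
exists g; split => //.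
  move=> a u v; apply: inner_extr => w.
  by rewrite !innerE -!gA !innerE.
move=> v.
(* The inner product is [sq (g v)], so its square is at most [sq v * (K * sq (g v))]; one factor
   [sq (g v)] is then divided out. *)
have := csq_inner_le v (f (g v)); rewrite gP.
rewrite (ip_sqn (inner_sip H1)) -/(sq (g v)) /csq !reimE expr0n addr0 => le1.
have [-> |gv] := eqVneq (sq (g v)) 0.
  by rewrite mulr_ge0// sq_ge0.
have gv0 : 0 < sq (g v) by rewrite lt_def gv sq_ge0.
rewrite -(ler_pM2r gv0) -expr2; apply: (le_trans le1).
by rewrite [K * _]mulrC -mulrA ler_wpM2l ?sq_ge0.
Qed.

End BoundedOperators.

(** * Commutants and support projections *)

Section VonNeumannAlgebras.
Context {R : realType}.

(** The analogue of [bounded_operator] between two spaces, with a real constant for squared norms;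
    [boundedP] identifies the two notions on a single space. *)
Definition bounded_linear (H1 H2 : hilbertType R) (f : H1 -> H2) :=
  linear f /\ exists2 K : R, 0 <= K & forall v, sq (f v) <= K * sq v.

Lemma adherent_image (H1 H2 : hilbertType R) (f : H1 -> H2) (K : set H1) (L : set H2) x :
  bounded_linear f -> (forall k, K k -> L (f k)) ->
  adherent inner K x -> adherent inner L (f x).
Proof.
move=> [f_lin [C C0 fC]] KL xK e e0.
have C1 : 0 < C + 1 by rewrite ltr_wpDl.
have [k Kk xk] := xK (e / (C + 1)) (divr_gt0 e0 C1).
exists (f k); first exact: KL.
rewrite -(linB f_lin); apply: (le_lt_trans (fC _)).
move: xk; rewrite -/(sq (x - k)) ltr_pdivlMr// => xk.
apply: le_lt_trans xk; rewrite mulrDr mulr1 mulrC lerDl; exact: sq_ge0.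
Qed.

Lemma adherent_eq (H1 H2 : hilbertType R) (f g : H1 -> H2) (K : set H1) x :
  bounded_linear f -> bounded_linear g -> (forall k, K k -> f k = g k) ->
  adherent inner K x -> f x = g x.
Proof.
move=> [f_lin [C C0 fC]] [g_lin [D D0 gD]] fg xK.
apply/eqP; rewrite -subr_eq0; apply/eqP/sq_eq0.
apply: (@eq0_small _ _ (2 * C + 2 * D)); first exact: sq_ge0.
move=> e /xK[k Kk /ltW xk].
have -> : f x - g x = f (x - k) + g (k - x).
  by rewrite (linB f_lin) (linB g_lin) (fg _ Kk) subrKA.
apply: (le_trans (sqD_le _ _)); rewrite [leRHS]mulrDl -!mulrA.
apply: lerD; rewrite ler_pM2l//.
  by apply: (le_trans (fC _)); rewrite ler_wpM2l.
by apply: (le_trans (gD _)); rewrite sqBC ler_wpM2l.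
Qed.

Context {H : hilbertType R}.
Implicit Types (x y c p : H -> H) (S : set (H -> H)) (O : H).

Lemma bounded_id : bounded_operator (idfun : H -> H).
Proof. by apply/boundedP; split => //; exists 1 => // v; rewrite mul1r. Qed.

Lemma bounded_comp (H1 H2 H3 : hilbertType R) (f : H2 -> H3) (g : H1 -> H2) :
  bounded_linear f -> bounded_linear g -> bounded_linear (f \o g).
Proof.
move=> [f_lin [C C0 fC]] [g_lin [D D0 gD]]; split.
  by move=> a u v /=; rewrite g_lin f_lin.
exists (C * D) => [|v]; first exact: mulr_ge0.
by rewrite -mulrA; apply: (le_trans (fC _)); rewrite ler_wpM2l.
Qed.

Lemma bounded_lin x a y : bounded_operator x -> bounded_operator y ->
  bounded_operator (a *: x + y).
Proof.
move=> /boundedP[x_lin [C C0 xC]] /boundedP[y_lin [D D0 yD]].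
apply/boundedP; split.
  move=> b u v; rewrite !fctE x_lin y_lin !scalerDr !scalerA mulrC.
  by rewrite -!addrA; congr (_ + _); rewrite addrCA.
exists (2 * (csq a * C) + 2 * D) => [|v].
  by rewrite addr_ge0 ?mulr_ge0 ?csq_ge0.
rewrite !fctE; apply: (le_trans (sqD_le _ _)); rewrite [leRHS]mulrDl -!mulrA.
have -> : sq (a *: x v) = csq a * sq (x v) by exact: sqnZ (inner_sip H) _ _.
by apply: lerD; rewrite ler_pM2l//; apply: ler_wpM2l; rewrite ?csq_ge0.
Qed.

Lemma adjoint_exists x : bounded_operator x ->
  exists2 y, bounded_operator y & adjoint x y.
Proof.
move=> /boundedP[x_lin [K K0 xK]].
have [y [y_lin yK xy]] := adjoint_exists_gen K0 x_lin xK.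
by exists y => //; apply/boundedP; split => //; exists K.
Qed.

Lemma adjoint_sym x y : adjoint x y -> adjoint y x.
Proof. by move=> xy u v; rewrite innerC -xy -innerC. Qed.

Lemma adjoint_comp x x' y y' :
  adjoint x x' -> adjoint y y' -> adjoint (x \o y) (y' \o x').
Proof. by move=> xx yy u v /=; rewrite xx yy. Qed.

Lemma adjoint_uniq x y y' : adjoint x y -> adjoint x y' -> y = y'.
Proof. by move=> xy xy'; apply/funext => v; apply: inner_extr => u; rewrite -xy. Qed.

Definition star_closed S := forall x, S x ->
  bounded_operator x /\ exists2 y, S y & adjoint x y.

(** If [y] is the adjoint of [x] in [S], taking adjoints in [y \o c = c \o y] shows that the adjoint
    of [c] commutes with [x]. *)
Lemma commutant_star_closed S : star_closed S -> star_closed (commutant S).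
Proof.
move=> SS c [cb cS]; split => //.
have [d db cd] := adjoint_exists cb; exists d => //; split => // x Sx.
have [xb [y Sy xy]] := SS _ Sx.
have := adjoint_comp cd (adjoint_sym xy); rewrite -cS// => h.
exact: adjoint_uniq (adjoint_comp (adjoint_sym xy) cd).
Qed.

Lemma bicommutant_star_closed S : star_closed S -> star_closed (bicommutant S).
Proof. by move=> /commutant_star_closed/commutant_star_closed. Qed.

Lemma sub_bicommutant S : star_closed S -> S `<=` bicommutant S.
Proof.
by move=> SS x Sx; split=> [|c [cb cS]]; [case: (SS _ Sx)|rewrite cS].
Qed.

Lemma commutant_id S : commutant S idfun.
Proof. by split => //; exact: bounded_id. Qed.

Lemma commutant_lin S a x y : star_closed S ->
  commutant S x -> commutant S y -> commutant S (a *: x + y).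
Proof.
move=> SS [xb xS] [yb yS]; split; first exact: bounded_lin.
move=> z Sz; have [[z_lin _] _] := SS _ Sz.
apply/funext => v; rewrite /= !fctE z_lin.
by rewrite -[z (x v)]/((z \o x) v) xS// -[z (y v)]/((z \o y) v) yS.
Qed.

Lemma commutant_comp S x y : commutant S x -> commutant S y ->
  commutant S (x \o y).
Proof.
move=> [/boundedP xb xS] [/boundedP yb yS]; split.
  by apply/boundedP/(@bounded_comp H H H).
by move=> z Sz; rewrite compA xS// -compA yS.
Qed.

Lemma orthogonal_projection_exists (K : set H) : lin_subset K -> exists p,
  [/\ projection p, forall v, adherent inner K (p v),
      forall v k, K k -> inner k (v - p v) = 0 &
      forall v w, adherent inner K w ->
        (forall k, K k -> inner k (v - w) = 0) -> p v = w].
Proof.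
move=> KL.
have [p [p_lin p_le pA p_adh [p_orth p_uniq]]] :=
  projection_exists (inner_sip H) (@inner_complete _ H) (@sq_eq0 _ H) KL.
exists p; split => //; split => //.
  by apply/boundedP; split => //; exists 1 => // v; rewrite mul1r; exact: p_le.
apply/funext => v /=; apply: p_uniq => // k Kk.
by rewrite subrr inner0r.
Qed.

(** Since [P] is a projection, |P O - O|^2 = <O, O> - <O, P O>, which the support condition makes
    zero. *)
Lemma support_fix S O P : support_projection S (vector_functional O) P -> P O = O.
Proof.
move=> [[_ PP PA] _ PO _]; apply/eqP; rewrite -subr_eq0; apply/eqP/sq_eq0.
rewrite /sq /sqn !innerE !PA -[P (P O)]/((P \o P) O) PP.
move: PO; rewrite /vector_functional => ->.
by rewrite subrr opprK addNr addr0.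
Qed.

(** The closed commutant orbit of [O] is invariant under a star-closed set, so its projection
    commutes with the commutant; minimality of [P] then applies. *)
Lemma support_range S O P : star_closed S ->
  support_projection (bicommutant S) (vector_functional O) P ->
  forall v, adherent inner [set c O | c in commutant S] (P v).
Proof.
move=> SS Psupp v; set K := [set c O | c in commutant S].
have KL : lin_subset K.
  split=> [|a _ _ [c cS <-] [d dS <-]].
    exists (-1 *: (idfun : H -> H) + idfun).
      by apply: commutant_lin => //; exact: commutant_id.
    by rewrite !fctE scaleN1r addNr.
  by exists (a *: c + d) => //; exact: commutant_lin.
(* This projection fixes [O] and lies in the bicommutant, so it dominates [P]. *)
have [p [pproj padh porth puniq]] := orthogonal_projection_exists KL.
have pM : bicommutant S p.
  split; first by case: pproj.
  move=> c cS; have [cb [d dS cd]] := commutant_star_closed SS cS.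
  apply/esym/funext => u /=; apply: puniq.
    apply: (adherent_image (K := K)) => //; first exact/boundedP.
    by move=> _ [e eS <-]; exists (c \o e) => //; exact: commutant_comp.
  move=> _ [e eS <-]; rewrite -(linB cb.1) -(adjoint_sym cd).
  by apply: porth; exists (d \o e) => //; exact: commutant_comp.
have OK : K O by exists idfun => //; exact: commutant_id.
have pO : p O = O.
  apply: puniq; first exact: adherent_in (inner_sip H) _ _ OK.
  by move=> k _; rewrite subrr inner0r.
have [_ _ _ /(_ p pproj pM)] := Psupp.
rewrite /vector_functional pO => /(_ erefl) <-.
exact: padh.
Qed.

End VonNeumannAlgebras.

(** * Isometries and their construction from dense families *)

Section Isometries.
Context {R : realType} {H1 H2 : hilbertType R}.

Lemma dense_ext (K : set H1) (x y : H1) : (forall v, adherent inner K v) ->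
  (forall k, K k -> inner k x = inner k y) -> x = y.
Proof.
move=> Kd xy; apply/eqP; rewrite -subr_eq0; apply/eqP/sq_eq0.
rewrite /sq /sqn (@orthogonal_adherent _ _ _ (inner_sip H1) K)// => k Kk.
by rewrite innerDr innerNr xy// subrr.
Qed.

Definition isometry (V : H1 -> H2) := forall x y, inner (V x) (V y) = inner x y.

(** Preservation of inner products already forces linearity: the defect
    [V (a *: x + y) - (a *: V x + V y)] is orthogonal to the range of [V], and it is a combination
    of vectors of that range. *)
Lemma isometry_bounded V : isometry V -> bounded_linear V.
Proof.
move=> Viso; split; last first.
  by exists 1 => // v; rewrite /sq /sqn Viso mul1r.
move=> a x y; apply/eqP; rewrite -subr_eq0; apply/eqP/sq_eq0.
set z := _ - _; have zV t : inner z (V t) = 0.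
  by rewrite /z !innerE !Viso !innerE subrr.
by rewrite /sq /sqn {2}/z innerDr innerNr innerDr innerZr !zV mulr0 addr0 subrr.
Qed.

(** The graph of the extension is the relation [G]: [x] and [z] are approximated by [u i] and [v i]
    with common indices. [G] preserves inner products, and it is total by completeness of [H2], so
    any choice function for it is the isometry. *)
Lemma isometry_extension (I : Type) (u : I -> H1) (v : I -> H2) :
  (forall i j, inner (v i) (v j) = inner (u i) (u j)) ->
  (forall x, adherent inner (range u) x) ->
  exists V, isometry V /\ forall i, V (u i) = v i.
Proof.
move=> vu ud.
pose G x z := forall e : R, 0 < e -> exists i, sq (x - u i) < e /\ sq (z - v i) < e.
have sq_vu i j : sq (v i - v j) = sq (u i - u j).
  by rewrite /sq /sqn !innerE !vu.
have Gv x z j : G x z -> inner z (v j) = inner x (u j).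
  move=> Gxz; apply/eqP; rewrite -subr_eq0; apply/eqP/csq_eq0.
  apply: (@eq0_small _ _ (2 * sq (v j) + 2 * sq (u j))); first exact: csq_ge0.
  move=> e /Gxz[i [/ltW xu /ltW zv]].
  have -> : inner z (v j) - inner x (u j)
      = inner (z - v i) (v j) + inner (u i - x) (u j).
    by rewrite !innerDl !innerNl vu subrKA.
  apply: (le_trans (csqD_le _ _)); rewrite [leRHS]mulrDl -!mulrA.
  apply: lerD; rewrite ler_pM2l// mulrC;
    apply: (le_trans (csq_inner_le _ _)); apply: ler_wpM2r => //; try exact: sq_ge0.
  by rewrite sqBC.
have Ginner x y z w : G x z -> G y w -> inner z w = inner x y.
  move=> Gxz Gyw; apply/eqP; rewrite -subr_eq0; apply/eqP/csq_eq0.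
  apply: (@eq0_small _ _ (2 * sq z + 2 * sq x)); first exact: csq_ge0.
  move=> e /Gyw[i [/ltW yu /ltW wv]].
  have -> : inner z w - inner x y = inner z (w - v i) + inner x (u i - y).
    by rewrite !innerDr !innerNr (Gv x)// subrKA.
  apply: (le_trans (csqD_le _ _)); rewrite [leRHS]mulrDl -!mulrA.
  apply: lerD; rewrite ler_pM2l//;
    apply: (le_trans (csq_inner_le _ _)); apply: ler_wpM2l => //; try exact: sq_ge0.
  by rewrite sqBC.
have Gex x : exists z, G x z.
  have [r r_gt0 r_small] := @small_sequence R.
  have /choice[i iP] : forall n, exists i, sq (x - u i) < r n.
    by move=> n; have [_ [i _ <-] xi] := ud x _ (r_gt0 n); exists i.
  have [|z zP] := @inner_complete _ H2 (v \o i).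
    move=> e e0; have e4 : 0 < e / 4 by lra.
    have [N NP] := r_small _ e4; exists N => m n /NP rm /NP rn.
    rewrite -/(sq _) /= sq_vu.
    have -> : u (i m) - u (i n) = (x - u (i n)) + (u (i m) - x).
      by rewrite [RHS]addrC subrKA.
    have := sqD_le (x - u (i n)) (u (i m) - x).
    rewrite [sq (u (i m) - x)]sqBC; have := iP m; have := iP n; lra.
  exists z => e e0; have [N1 N1P] := r_small _ e0; have [N2 N2P] := zP _ e0.
  exists (i (maxn N1 N2)); split.
    by apply: (lt_trans (iP _)); rewrite N1P// leq_maxl.
  by rewrite sqBC; apply: N2P; rewrite leq_maxr.
have /choice[V VP] := Gex.
exists V; split=> [x y|i]; first exact: Ginner.
have Gi : G (u i) (v i) by move=> e e0; exists i; rewrite !subrr !sq0.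
apply/eqP; rewrite -subr_eq0; apply/eqP/sq_eq0.
by rewrite /sq /sqn !innerE !(Ginner _ _ _ _ (VP _) (VP _), Ginner _ _ _ _ Gi (VP _),
  Ginner _ _ _ _ (VP _) Gi, vu) subrr subrr addr0.
Qed.

Lemma isometry_adjoint V : isometry V -> exists W : H2 -> H1,
  [/\ bounded_linear W, forall x y, inner (V x) y = inner x (W y) &
      forall x, W (V x) = x].
Proof.
move=> Viso; have [V_lin _] := isometry_bounded Viso.
have [|||W [W_lin WK VW]] := @adjoint_exists_gen _ H1 H2 V 1 => //.
  by move=> v; rewrite /sq /sqn Viso mul1r.
exists W; split => //; first by split => //; exists 1.
by move=> x; apply: inner_extr => v; rewrite -VW Viso.
Qed.

End Isometries.

(** * Intertwiners between representations with the same vector state *)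

Section Intertwiner.
Context {R : realType} {A : cstarType R} {H0 H : hilbertType R}.
Context (pi0 : A -> H0 -> H0) (rho : A -> H -> H) (O0 : H0) (O : H).
Hypothesis pi0_rep : representation pi0.
Hypothesis rho_rep : representation rho.
Hypothesis cyclic : closure [set pi0 a O0 | a in [set: A]] = [set: H0].
Hypothesis same_state : forall a, inner O (rho a O) = inner O0 (pi0 a O0).

Lemma rep_star_closed (K : hilbertType R) (sigma : A -> K -> K) :
  representation sigma -> star_closed (range sigma).
Proof.
move=> [sb _ _ sA] _ [a _ <-]; split => //.
by exists (sigma (star a)) => //; exists (star a).
Qed.

Lemma rep_inner (K : hilbertType R) (sigma : A -> K -> K) : representation sigma ->
  forall v a b, inner (sigma a v) (sigma b v) = inner v (sigma (cmul (star a) b) v).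
Proof. by move=> [_ _ sM sA] v a b; rewrite sA sM. Qed.

Lemma cyclic_dense x : adherent inner (range (fun a => pi0 a O0)) x.
Proof. by apply/closure_sqP; rewrite cyclic. Qed.

Definition intertwiner (V : H0 -> H) :=
  [/\ isometry V, V O0 = O & forall a x, V (pi0 a x) = rho a (V x)].

(** The extension of [pi0 a O0 |-> rho a O] need not visibly send [O0] to [O]. Its adjoint [W]
    satisfies [W O = O0], as tests on the dense orbit show, whence |V O0 - O|^2 = |O|^2 - |O0|^2. *)
Lemma intertwiner_exists : sq O = sq O0 -> exists V, intertwiner V.
Proof.
move=> sqO.
have [|V [Viso VO]] := isometry_extension _ cyclic_dense (v := fun a => rho a O).
  by move=> a b; rewrite !rep_inner.
have [W [Wb VW WV]] := isometry_adjoint Viso.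
have WO : W O = O0.
  apply: (dense_ext cyclic_dense) => _ [a _ <-]; rewrite -VW VO.
  by rewrite innerC [RHS]innerC same_state.
exists V; split => //.
  apply/eqP; rewrite -subr_eq0; apply/eqP/sq_eq0.
  rewrite /sq /sqn !innerE Viso VW WO (innerC O) VW WO -innerC.
  by move: sqO; rewrite !(ip_sqn (inner_sip _)) /sq !reimE => ->; lra.
have Vb := isometry_bounded Viso.
move=> a x; have [pb _ pM _] := pi0_rep; have [rb _ rM _] := rho_rep.
apply: (adherent_eq (K := range (fun a => pi0 a O0))
  (f := V \o pi0 a) (g := rho a \o V)); last exact: cyclic_dense.
- by apply: bounded_comp => //; exact/boundedP.
- by apply: bounded_comp => //; exact/boundedP.
move=> _ [b _ <-] /=; rewrite VO.
by rewrite -[pi0 a (pi0 b O0)]/((pi0 a \o pi0 b) O0) -pM VO rM.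
Qed.

(* [P] and [F] project onto the closures of the commutant orbits of [O0] and
   [O], which [c |-> V c V*] and [d |-> V* d V] exchange. *)
Lemma intertwiner_support V P F : intertwiner V ->
  support_projection (bicommutant (range pi0)) (vector_functional O0) P ->
  support_projection (bicommutant (range rho)) (vector_functional O) F ->
  forall x, V (P x) = F (V x).
Proof.
move=> [Viso VO Vrep] Psupp Fsupp x.
have PO := support_fix Psupp; have FO := support_fix Fsupp.
have Prange := support_range (rep_star_closed pi0_rep) Psupp.
have Frange := support_range (rep_star_closed rho_rep) Fsupp.
have [[Pb PP PA] _ _ _] := Psupp; have [[Fb FF FA] FM _ _] := Fsupp.
have [W [Wb VW WV]] := isometry_adjoint Viso.
have Vb := isometry_bounded Viso; have WO : W O = O0 by rewrite -VO WV.
have Wrep a y : W (rho a y) = pi0 a (W y).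
  have [_ _ _ pA] := pi0_rep; have [_ _ _ rA] := rho_rep.
  apply: inner_extr => v.
  by rewrite -VW -(adjoint_sym (rA a)) -Vrep VW (adjoint_sym (pA a)).
have VcW c : commutant (range pi0) c -> commutant (range rho) (V \o c \o W).
  move=> [/boundedP cb cS]; split.
    by apply/boundedP/bounded_comp => //; apply: bounded_comp.
  move=> _ [a _ <-]; apply/funext => y /=; rewrite -Vrep Wrep.
  have := cS (pi0 a); rewrite /comp => /(_ (ex_intro2 _ _ a I erefl)).
  by move=> /(congr1 (@^~ (W y))) /= ->.
have WdV d : commutant (range rho) d -> commutant (range pi0) (W \o d \o V).
  move=> [/boundedP db dS]; split.
    by apply/boundedP/bounded_comp => //; apply: bounded_comp.
  move=> _ [a _ <-]; apply/funext => y /=; rewrite -Wrep Vrep.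
  have := dS (rho a); rewrite /comp => /(_ (ex_intro2 _ _ a I erefl)).
  by move=> /(congr1 (@^~ (V y))) /= ->.
(* [F] commutes with [V \o c \o W] and fixes [O], hence fixes [V (c O0)]; such vectors approximate
   [V (P y)]. *)
have FVP y : F (V (P y)) = V (P y).
  apply: (adherent_eq (f := F \o V) (g := V) _ _ _ (Prange y)) => //.
    by apply: bounded_comp => //; exact/boundedP.
  move=> _ [c cS <-] /=.
  have [_ /(_ _ (VcW _ cS))] := FM; rewrite /comp => /(congr1 (@^~ O)) /=.
  by rewrite WO FO WO.
(* Dually, [W (d O) = (W \o d \o V) O0] is fixed by [P], so [V (x - P x)] is orthogonal to every
   [d O], and thus to the range of [F]. *)
have FVQ : F (V (x - P x)) = 0.
  apply: inner_extr => w; rewrite -FA inner0r.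
  apply: (orthogonal_adherent (inner_sip H) _ (Frange w)) => _ [d dS <-].
  rewrite innerC VW -innerC.
  have -> : W (d O) = P (W (d O)).
    have [_ PM _ _] := Psupp; have [_ /(_ _ (WdV _ dS))] := PM.
    by rewrite /comp => /(congr1 (@^~ O0)) /=; rewrite PO VO.
  by rewrite PA (linB Pb.1) -[P (P x)]/((P \o P) x) PP subrr inner0r.
have := FVQ; rewrite (linB Vb.1) (linB Fb.1) => /eqP.
by rewrite subr_eq0 FVP => /eqP.
Qed.

End Intertwiner.

(** * Sigma-weak density and normal maps *)

Section ComplexSeries.
Context {R : realType}.
Implicit Types (c d : nat -> Cplx R) (l m : Cplx R).

Lemma ccvg_nP c l : c @ \oo --> l <->
  forall e : R, 0 < e -> exists N, forall n, (N <= n)%N -> csq (c n - l) < e.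
Proof.
split=> [/(ccvg_sqP (F := \oo)) cl e /cl[N _ NP]|cl]; first by exists N.
by apply/(ccvg_sqP (F := \oo)) => e /cl[N NP]; exists N.
Qed.

Lemma series_lin (a : Cplx R) c d l m : series c @ \oo --> l -> series d @ \oo --> m ->
  series (fun n => a * c n + d n) @ \oo --> a * l + m.
Proof.
move=> cl dm.
have -> : series (fun n => a * c n + d n) = (fun n => a * series c n + series d n).
  by apply/funext => n; rewrite /series /= big_split /= mulr_sumr.
apply/ccvg_nP => e e0.
have a1 : 0 < 2 * csq a + 2 by have := csq_ge0 a; lra.
have d0 : 0 < e / (2 * csq a + 2) by exact: divr_gt0.
move/ccvg_nP : cl => /(_ _ d0)[N1 N1P]; move/ccvg_nP : dm => /(_ _ d0)[N2 N2P].
exists (maxn N1 N2) => n Nn.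
have {N1P} := N1P n (leq_trans (leq_maxl _ _) Nn).
have {N2P} := N2P n (leq_trans (leq_maxr _ _) Nn).
rewrite opprD addrACA -mulrBr => lt2 /ltW le1.
apply: (le_lt_trans (csqD_le _ _)); rewrite csqM.
have -> : e = 2 * (csq a * (e / (2 * csq a + 2))) + 2 * (e / (2 * csq a + 2)).
  by field; rewrite gt_eqF.
by rewrite ler_ltD// ?ler_wpM2l ?csq_ge0// ltr_pM2l.
Qed.

Lemma series_conj c l : series c @ \oo --> l ->
  series (fun n => (c n)^*) @ \oo --> l^*.
Proof.
move=> /ccvg_nP cl; apply/ccvg_nP => e /cl[N NP]; exists N => n /NP.
rewrite /series /= -rmorph_sum -rmorphB /csq; congr (_ < _).
by rewrite re_conj im_conj sqrrN.
Qed.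

Lemma series_re c l : series c @ \oo --> l ->
  series (fun n => re (c n)) @ \oo --> re l.
Proof.
move=> /ccvg_nP cl; apply/cvgrPdist_lt => e e0.
have [N NP] := cl _ (exprn_gt0 2 e0); exists N => // n /NP lt_e /=.
have reS k : series (fun n => re (c n)) k = re (series c k).
  by rewrite /series /= (big_morph re (@reD R) (erefl : re (0 : Cplx R) = 0)).
rewrite reS distrC -reN -reD -(@ltr_pXn2r _ 2)// ?nnegrE ?(ltW e0)// (real_normK (num_real _)).
by apply: le_lt_trans lt_e; rewrite lerDl sqr_ge0.
Qed.

Lemma real_series_cvg (d b : nat -> R) (M : R) :
  (forall n, `|d n| <= b n) -> (forall n, series b n <= M) -> cvgn (series d).
Proof.
move=> db bM; apply: normed_cvg; apply: (series_le_cvg (v_ := b)) => //.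
- by move=> n; exact: normr_ge0.
- by move=> n; exact: le_trans (db n).
apply: nondecreasing_is_cvgn.
  by apply: nondecreasing_series => n _ _; exact: le_trans (db n).
by exists M => _ [n _ <-].
Qed.

Lemma complex_series_cvg c (b : nat -> R) (M : R) : (forall n, 0 <= b n) ->
  (forall n, csq (c n) <= b n ^+ 2) -> (forall n, series b n <= M) ->
  cvgn (series c).
Proof.
move=> b0 cb bM.
have rec : cvgn (series (fun n => re (c n))).
  apply: real_series_cvg bM => n; rewrite -(@ler_pXn2r _ 2) ?nnegrE// (real_normK (num_real _)).
  by apply: le_trans (cb n); rewrite lerDl sqr_ge0.
have imc : cvgn (series (fun n => im (c n))).
  apply: real_series_cvg bM => n; rewrite -(@ler_pXn2r _ 2) ?nnegrE// (real_normK (num_real _)).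
  by apply: le_trans (cb n); rewrite lerDr sqr_ge0.
have sE n : series c n = (series (fun n => re (c n)) n +i* series (fun n => im (c n)) n)%C.
  rewrite /series /=; elim: n => [|n IH]; first by rewrite !big_geq.
  by rewrite !big_nat_recr //= IH; case: (c n).
apply/cvg_ex; exists (lim (series (fun n => re (c n)) @ \oo) +i*
  lim (series (fun n => im (c n)) @ \oo))%C.
apply/ccvg_nP => e e0.
have e2 : 0 < Num.sqrt (e / 2) by rewrite sqrtr_gt0; lra.
move/cvgrPdist_lt : rec => /(_ _ e2)[N1 _ N1P].
move/cvgrPdist_lt : imc => /(_ _ e2)[N2 _ N2P].
exists (maxn N1 N2) => n Nn.
have {N1P} := N1P n (leq_trans (leq_maxl _ _) Nn).
have {N2P} := N2P n (leq_trans (leq_maxr _ _) Nn).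
have sqr_lt (x : R) : `|x| < Num.sqrt (e / 2) -> x ^+ 2 < e / 2.
  move=> lt_x; rewrite -[e / 2]sqr_sqrtr; last by lra.
  by rewrite -(real_normK (num_real x)) ltr_pXn2r ?nnegrE ?sqrtr_ge0.
rewrite sE /csq distrC => /sqr_lt lt_im; rewrite distrC => /sqr_lt lt_re.
by rewrite !reimE [re (_ +i* _)%C]/= [im (_ +i* _)%C]/=; move: lt_re lt_im; rewrite /re /im /=; lra.
Qed.

End ComplexSeries.

(** * The Hilbert space l2(H) *)

Section SquareSummableSequences.
Context {R : realType} {H : hilbertType R}.
Implicit Types (w : nat -> H).

Definition sq_series w : nat -> R := series (fun i => sq (w i)).

Lemma sq_seriesS w n : sq_series w n.+1 = sq_series w n + sq (w n).
Proof. by rewrite /sq_series /series /= big_nat_recr. Qed.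

Lemma sq_series0 w : sq_series w 0 = 0.
Proof. by rewrite /sq_series /series /= big_geq. Qed.

Lemma sq_series_ge0 w n : 0 <= sq_series w n.
Proof. by apply: sumr_ge0 => i _; exact: sq_ge0. Qed.

Lemma sq_series_mono w m n : (m <= n)%N -> sq_series w m <= sq_series w n.
Proof.
by move=> mn; apply: nondecreasing_series => // k _ _; exact: sq_ge0.
Qed.

Lemma sq_seriesD_le w w' n :
  sq_series (w + w') n <= 2 * sq_series w n + 2 * sq_series w' n.
Proof.
rewrite /sq_series /series /= !mulr_sumr -big_split /=.
by apply: ler_sum => i _; exact: sqD_le.
Qed.

Lemma sq_seriesN w n : sq_series (- w) n = sq_series w n.
Proof. by apply: eq_bigr => i _; exact: sqnN (inner_sip H) _. Qed.

Lemma sq_seriesZ (a : Cplx R) w n : sq_series (a *: w) n = csq a * sq_series w n.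
Proof.
rewrite /sq_series /series /= mulr_sumr; apply: eq_bigr => i _.
exact: sqnZ (inner_sip H) a _.
Qed.

(** Square summability as boundedness of the partial sums, so that stability under linear
    combinations is a plain inequality; [square_summable_ell2] links it to [square_summable]. *)
Definition ell2_pred : {pred nat -> H} :=
  [pred w : nat -> H | `[< exists M, forall n, sq_series w n <= M >]].

Fact ell2_submod : submod_closed ell2_pred.
Proof.
split=> [|a u v /asboolP[M uM] /asboolP[N vN]]; apply/asboolP.
  exists 0 => n; elim: n => [|n IH]; first by rewrite sq_series0.
  by rewrite sq_seriesS sq0 addr0.
exists (2 * (csq a * M) + 2 * N) => n; apply: (le_trans (sq_seriesD_le _ _ _)).
by apply: lerD; rewrite ler_pM2l// sq_seriesZ ler_wpM2l// csq_ge0.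
Qed.

HB.instance Definition _ :=
  GRing.isSubmodClosed.Build (Cplx R) (nat -> H) ell2_pred ell2_submod.

Record ell2 := Ell2 { ell2_seq :> nat -> H ; _ : ell2_seq \in ell2_pred }.

HB.instance Definition _ := [isSub for ell2_seq].
HB.instance Definition _ := [Choice of ell2 by <:].
HB.instance Definition _ := [SubChoice_isSubLmodule of ell2 by <:].

Implicit Types u v : ell2.

Lemma ell2P v : exists M, forall n, sq_series v n <= M.
Proof. by have /asboolP := valP v. Qed.

Lemma ell2_ext u v : (forall i, u i = v i) -> u = v.
Proof. by move=> uv; apply: val_inj; exact/funext. Qed.

Lemma ell2DE u v i : (u + v) i = u i + v i. Proof. by []. Qed.
Lemma ell2NE u i : (- u) i = - u i. Proof. by []. Qed.
Lemma ell2ZE (a : Cplx R) u i : (a *: u) i = a *: u i. Proof. by []. Qed.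
Lemma ell20E i : (0 : ell2) i = 0. Proof. by []. Qed.

Definition ell2_inner u v : Cplx R := limn (series (fun i => inner (u i) (v i))).

Lemma ell2_inner_cvg u v :
  series (fun i => inner (u i) (v i)) @ \oo --> ell2_inner u v.
Proof.
have [M uM] := ell2P u; have [N vN] := ell2P v.
apply: (@complex_series_cvg _ _ (fun i => sq (u i) + sq (v i)) (M + N)) => n.
- by rewrite addr_ge0 ?sq_ge0.
- apply: (le_trans (csq_inner_le _ _)).
  have := sq_ge0 (u n); have := sq_ge0 (v n); nra.
- rewrite /series /= big_split /=; exact: lerD (uM n) (vN n).
Qed.

Lemma ell2_innerE u v l :
  series (fun i => inner (u i) (v i)) @ \oo --> l -> ell2_inner u v = l.
Proof. exact: cvg_unique (@ell2_inner_cvg u v). Qed.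

Lemma ell2_sqn_cvg v : sq_series v @ \oo --> sqn ell2_inner v.
Proof. have := series_re (@ell2_inner_cvg v v); exact. Qed.

Lemma sq_series_le v n : sq_series v n <= sqn ell2_inner v.
Proof.
have h := @ell2_sqn_cvg v; rewrite -(cvg_lim _ h)//.
apply: nondecreasing_cvgn_le; last exact: cvgP h.
by move=> m k; exact: sq_series_mono.
Qed.

Lemma ell2_sqn_le v M : (forall n, sq_series v n <= M) -> sqn ell2_inner v <= M.
Proof.
move=> vM; have h := @ell2_sqn_cvg v; rewrite -(cvg_lim _ h)//.
by apply: limr_le; [exact: cvgP h|exact: nearW].
Qed.

Lemma sq_le_ell2 v i : sq (v i) <= sqn ell2_inner v.
Proof.
apply: le_trans (sq_series_le v i.+1); rewrite sq_seriesS lerDr.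
exact: sq_series_ge0.
Qed.

Lemma ell2_inner_sip : semi_inner_product ell2_inner.
Proof.
split=> [u a v w|u v|v].
- apply: ell2_innerE.
  have -> : (fun i => inner (u i) ((a *: v + w) i))
      = (fun i => a * inner (u i) (v i) + inner (u i) (w i)).
    by apply/funext => i; rewrite ell2DE ell2ZE innerDr innerZr.
  exact: series_lin (@ell2_inner_cvg u v) (@ell2_inner_cvg u w).
- apply: ell2_innerE.
  have -> : (fun i => inner (u i) (v i)) = (fun i => (inner (v i) (u i))^*).
    by apply/funext => i; exact: innerC.
  exact: series_conj (@ell2_inner_cvg v u).
- have : ell2_inner v v = (ell2_inner v v)^*.
    apply: ell2_innerE.
    have -> : (fun i => inner (v i) (v i)) = (fun i => (inner (v i) (v i))^*).
      by apply/funext => i; exact: innerC.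
    exact: series_conj (@ell2_inner_cvg v v).
  move=> /(congr1 im); rewrite im_conj => im0.
  have := sq_series_le v 0; rewrite sq_series0 /sqn => re0.
  rewrite lecE; apply/andP; split; last exact: re0.
  by apply/eqP; move: im0; rewrite /im /=; lra.
Qed.

Lemma ell2_definite v : sqn ell2_inner v = 0 -> v = 0.
Proof.
move=> v0; apply: ell2_ext => i; apply: sq_eq0; apply/eqP.
by rewrite eq_le sq_ge0 andbT -v0 sq_le_ell2.
Qed.

(** The limit [z] is taken coordinatewise. Convergence of each finite partial sum ([tail]) is
    upgraded to a bound uniform in the length ([unif]), which also puts [z] in l2(H). *)
Lemma ell2_complete : sqn_complete ell2_inner.
Proof.
move=> u uC.
have /choice[z zP] : forall i, exists z : H, forall e : R, 0 < e ->
    exists N, forall n, (N <= n)%N -> sq (u n i - z) < e.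
  move=> i; apply: (@inner_complete _ H (fun n => u n i)) => e /uC[N NP].
  exists N => m n Nm Nn; apply: le_lt_trans (NP _ _ Nm Nn).
  exact: (sq_le_ell2 (u m - u n)).
have tail (K : nat) (e : R) : 0 < e -> exists N, forall n, (N <= n)%N ->
    sq_series ((u n : nat -> H) - z) K < e.
  elim: K e => [|K IH] e e0; first by exists 0%N => n _; rewrite sq_series0.
  have e2 : 0 < e / 2 by lra.
  have [N1 N1P] := IH _ e2; have [N2 N2P] := zP K _ e2.
  exists (maxn N1 N2) => n Nn; rewrite sq_seriesS.
  have := N1P n (leq_trans (leq_maxl _ _) Nn).
  have := N2P n (leq_trans (leq_maxr _ _) Nn).
  rewrite !fctE; lra.
(* The intermediate index [m] depends on [K], but the resulting bound 2(e/4) + 2(e/4) does not. *)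
have unif (e : R) : 0 < e -> exists N, forall n, (N <= n)%N -> forall K,
    sq_series ((u n : nat -> H) - z) K <= e.
  move=> e0; have e4 : 0 < e / 4 by lra.
  have [N NP] := uC _ e4; exists N => n Nn K.
  have [N' N'P] := tail K _ e4.
  have := N'P _ (leq_maxr N N'); have := NP _ _ Nn (leq_maxl N N').
  set m := maxn N N' => unm umz.
  have -> : ell2_seq (u n) - z = ell2_seq (u n - u m) + (ell2_seq (u m) - z).
    apply/funext => i; rewrite -[LHS]/(u n i - z i).
    by rewrite -[RHS]/(u n i - u m i + (u m i - z i)) subrKA.
  apply: (le_trans (sq_seriesD_le _ _ _)).
  have := sq_series_le (u n - u m) K; lra.
have z_ell2 : z \in ell2_pred.
  apply/asboolP; have [N /(_ N (leqnn _)) NP] := unif 1 ltr01.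
  exists (2 * 1 + 2 * sqn ell2_inner (u N)) => n.
  have -> : z = - ((u N : nat -> H) - z) + u N.
    apply/funext => i; rewrite -[RHS]/(- (u N i - z i) + u N i).
    by rewrite opprB subrK.
  apply: (le_trans (sq_seriesD_le _ _ _)); rewrite sq_seriesN.
  apply: lerD; rewrite ler_pM2l//; exact: sq_series_le.
exists (Ell2 z_ell2) => e e0; have e2 : 0 < e / 2 by lra.
have [N NP] := unif _ e2; exists N => n Nn.
apply: (@le_lt_trans _ _ (e / 2)); last by lra.
by apply: ell2_sqn_le => K; exact: NP.
Qed.

End SquareSummableSequences.

(** * Operators acting coordinatewise on l2(H) *)

Section Amplification.
Context {R : realType} {H : hilbertType R}.
Implicit Types (x y : H -> H) (w : ell2 (H := H)).

(** The default 0 of [insubd] is taken only if the image sequence is not square summable, which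
    [amplifyE] excludes for bounded operators. *)
Definition amplify x w : ell2 := insubd 0 (fun i => x (w i)).

Definition ell2_delta j (v : H) : ell2 := insubd 0 (fun i => if i == j then v else 0).

Lemma amplifyE x w i : bounded_operator x -> amplify x w i = x (w i).
Proof.
move=> /boundedP[x_lin [K K0 xK]].
suff xw : (fun i => x (w i)) \in ell2_pred.
  exact: (congr1 (@^~ i) (insubdK (0 : ell2) xw)).
have [M wM] := ell2P w; apply/asboolP; exists (K * M) => n.
apply: (@le_trans _ _ (K * sq_series w n)); last by rewrite ler_wpM2l.
by rewrite /sq_series /series /= mulr_sumr; apply: ler_sum => j _.
Qed.

Lemma ell2_deltaE j v i : ell2_delta j v i = if i == j then v else 0.
Proof.
suff vj : (fun i => if i == j then v else 0) \in ell2_pred.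
  exact: (congr1 (@^~ i) (insubdK (0 : ell2) vj)).
apply/asboolP; exists (sq v) => n.
elim: n => [|n IH]; first by rewrite sq_series0 sq_ge0.
rewrite sq_seriesS; have [->|nj] := eqVneq n j; last by rewrite sq0 addr0.
rewrite -[leRHS]add0r lerD// /sq_series /series /= big_nat big1// => k /andP[_ kj].
by rewrite ltn_eqF// sq0.
Qed.

Lemma sqn_delta_le j v : sqn ell2_inner (ell2_delta j v) <= sq v.
Proof.
apply: ell2_sqn_le => n.
elim: n => [|n IH]; first by rewrite sq_series0 sq_ge0.
rewrite sq_seriesS ell2_deltaE; have [->|nj] := eqVneq n j; last by rewrite sq0 addr0.
rewrite -[leRHS]add0r lerD// /sq_series /series /= big_nat big1// => k /andP[_ kj].
by rewrite ell2_deltaE ltn_eqF// sq0.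
Qed.

Lemma ell2_delta_lin j : linear (ell2_delta j).
Proof.
move=> a u v; apply: ell2_ext => i; rewrite ell2DE ell2ZE !ell2_deltaE.
by case: eqP => // _; rewrite scaler0 addr0.
Qed.

Lemma amplify_lin x : bounded_operator x -> linear (amplify x).
Proof.
move=> xb a u v; apply: ell2_ext => i; rewrite ell2DE ell2ZE !amplifyE//.
by rewrite ell2DE ell2ZE xb.1.
Qed.

Lemma amplify_le x : bounded_operator x -> exists2 K : R, 0 <= K &
  forall w, sqn ell2_inner (amplify x w) <= K * sqn ell2_inner w.
Proof.
move=> xb; have [_ [K K0 xK]] := (boundedP x).1 xb; exists K => // w.
apply: ell2_sqn_le => n.
apply: (@le_trans _ _ (K * sq_series w n)).
  rewrite /sq_series /series /= mulr_sumr; apply: ler_sum => j _.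
  by rewrite amplifyE.
by rewrite ler_wpM2l// sq_series_le.
Qed.

Lemma amplify_delta x j v : bounded_operator x ->
  amplify x (ell2_delta j v) = ell2_delta j (x v).
Proof.
move=> xb; apply: ell2_ext => i; rewrite amplifyE// !ell2_deltaE.
by case: eqP => // _; exact: lin0 xb.1.
Qed.

Lemma amplify_adjoint x y u v : bounded_operator x -> bounded_operator y ->
  adjoint x y -> ell2_inner (amplify x u) v = ell2_inner u (amplify y v).
Proof.
move=> xb yb xy; rewrite /ell2_inner.
have -> // : (fun i => inner (amplify x u i) (v i))
    = (fun i => inner (u i) (amplify y v i)).
by apply/funext => i; rewrite !amplifyE.
Qed.

Lemma ell2_finite_dense (K : set ell2) : lin_subset K ->
  (forall j v, K (ell2_delta j v)) -> forall w, adherent ell2_inner K w.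
Proof.
move=> [K0 Klin] Kd w e e0.
pose t n := \sum_(j < n) ell2_delta j (w j).
have t0 : t 0%N = 0 by rewrite /t big_ord0.
have tS n : t n.+1 = t n + ell2_delta n (w n) by rewrite /t big_ord_recr.
have tK n : K (t n).
  elim: n => [|n IH]; first by rewrite t0.
  by rewrite tS -[X in K (X + _)]scale1r; exact: Klin.
have tE n i : t n i = if (i < n)%N then w i else 0.
  elim: n => [|n IH]; first by rewrite t0 ltn0.
  rewrite tS ell2DE IH ell2_deltaE ltnS.
  have [lt_in|lt_ni|->] := ltngtP i n; by rewrite ?addr0 ?add0r.
have /cvgrPdist_lt /(_ _ e0)[N _ /(_ N (leqnn _)) /= wN] := @ell2_sqn_cvg _ _ w.
exists (t N) => //; apply: le_lt_trans wN.
apply: (@le_trans _ _ (sqn ell2_inner w - sq_series w N)); last exact: ler_norm.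
apply: ell2_sqn_le => n.
have wt i : (w - t N) i = if (i < N)%N then 0 else w i.
  by rewrite ell2DE ell2NE tE; case: ifP => _; rewrite ?subrr ?subr0.
(* The truncation error has vanishing terms below [N] and those of [w] from [N] on, so its partial
   sums and those of [w] up to [minn n N] add up to the partial sums of [w]. *)
have : sq_series (w - t N) n + sq_series w (minn n N) = sq_series w n.
  elim: n => [|n IH]; first by rewrite min0n !sq_series0 addr0.
  rewrite !sq_seriesS -IH wt; have [nN|nN] := ltnP n N.
    have -> : minn n.+1 N = n.+1 by apply/minn_idPl.
    by rewrite sq_seriesS sq0 addr0 addrA.
  have -> : minn n.+1 N = N by apply/minn_idPr; exact: leqW.
  by rewrite addrAC.
have := sq_series_le w n; have := sq_series_le w N.
by have [nN|nN] := leqP n N; lra.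
Qed.

End Amplification.

Section Density.
Context {R : realType} {A : cstarType R} {H : hilbertType R}.
Context (sigma : A -> H -> H) (O : H).
Hypothesis sigma_rep : representation sigma.
Hypothesis cyclic : closure [set sigma a O | a in [set: A]] = [set: H].
Local Notation q2 := (sqn (@ell2_inner R H)).
Local Notation sip2 := (@ell2_inner_sip R H).

(* The projection [p] onto the closure of [{sigma b eta}] in l2(H) commutes with
   the amplified representation, so its matrix entries lie in the commutant;
   hence the amplification of [m] commutes with [p], which fixes [eta]. *)
Lemma sigma_weak_density (m : H -> H) (eta : ell2) : bicommutant (range sigma) m ->
  forall e : R, 0 < e ->
    exists b, q2 (amplify m eta - amplify (sigma b) eta) < e.
Proof.
move=> [mb mC].
have [sb slin sM sA] := sigma_rep.
pose K := range (fun b => amplify (sigma b) eta).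
have KL : lin_subset K.
  have Klin (a : Cplx R) x y : K x -> K y -> K (a *: x + y).
    move=> [b _ <-] [c _ <-]; exists (a *: b + c) => //.
    apply: ell2_ext => i; rewrite ell2DE ell2ZE !amplifyE//.
    by rewrite slin.
  split=> //; have Ky : K (amplify (sigma 0) eta) by exists 0.
  by have := Klin (-1) _ _ Ky Ky; rewrite scaleN1r addNr.
have [p [p_lin p_le pA p_adh [p_orth p_uniq]]] :=
  projection_exists sip2 (@ell2_complete R H) (@ell2_definite R H) KL.
have p_fix k : K k -> p k = k.
  move=> Kk; apply: p_uniq; first exact: (adherent_in sip2).
  by move=> ? _; rewrite subrr (ip0r sip2).
have p_sigma b w : p (amplify (sigma b) w) = amplify (sigma b) (p w).
  apply: p_uniq.
    have [C C0 bC] := amplify_le (sb b); move=> e e0.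
    have C1 : 0 < C + 1 by rewrite ltr_wpDl.
    have [_ [c _ <-] pk] := p_adh w (e / (C + 1)) (divr_gt0 e0 C1).
    exists (amplify (sigma (cmul b c)) eta); first by exists (cmul b c).
    have -> : amplify (sigma (cmul b c)) eta = amplify (sigma b) (amplify (sigma c) eta).
      by apply: ell2_ext => i; rewrite !amplifyE// sM.
    rewrite -(linB (amplify_lin (sb b))); apply: (le_lt_trans (bC _)).
    move: pk; rewrite ltr_pdivlMr// => pk.
    apply: le_lt_trans pk; rewrite mulrDr mulr1 mulrC lerDl; exact: sqn_ge0 sip2 _.
  move=> _ [c _ <-]; rewrite -(linB (amplify_lin (sb b))).
  rewrite -(amplify_adjoint _ _ (sb (star b)) (sb b)); last exact: adjoint_sym.
  have -> : amplify (sigma (star b)) (amplify (sigma c) eta)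
      = amplify (sigma (cmul (star b) c)) eta.
    by apply: ell2_ext => i; rewrite !amplifyE// sM.
  by apply: p_orth; exists (cmul (star b) c).
pose pij i j v := p (ell2_delta j v) i.
have pijC i j : commutant (range sigma) (pij i j).
  split.
    apply/boundedP; split.
      by move=> a u v; rewrite /pij ell2_delta_lin p_lin.
    exists 1 => // v; rewrite mul1r.
    apply: (le_trans (sq_le_ell2 _ _)); apply: (le_trans (p_le _)).
    exact: sqn_delta_le.
  move=> _ [b _ <-]; apply/funext => v /=; rewrite /pij.
  by rewrite -amplify_delta// p_sigma amplifyE.
(* On one-coordinate sequences this is the commutation of [m] with the entries [pij]; linearity and
   density of finite sequences give the rest. *)
have pm w : p (amplify m w) = amplify m (p w).
  have m_lin := amplify_lin mb.
  pose L := [set w | p (amplify m w) = amplify m (p w)].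
  have LL : lin_subset L.
    split=> [|a u v Lu Lv]; rewrite /L /=; first by rewrite !(lin0 m_lin, lin0 p_lin).
    by rewrite !(m_lin, p_lin) Lu Lv.
  have Ldelta j v : L (ell2_delta j v).
    apply: ell2_ext => i; rewrite amplifyE// amplify_delta//.
    have := mC _ (pijC i j).
    by rewrite /comp => /(congr1 (@^~ v)) /= <-.
  have [C C0 mC'] := amplify_le mb.
  have wL := ell2_finite_dense LL Ldelta w.
  apply/eqP; rewrite -subr_eq0; apply/eqP/ell2_definite.
  apply: (@eq0_small _ _ (4 * C)); first exact: sqn_ge0 sip2 _.
  move=> e /wL[k Lk /ltW wk].
  have -> : p (amplify m w) - amplify m (p w)
      = p (amplify m (w - k)) + - amplify m (p (w - k)).
    rewrite !(linB m_lin, linB p_lin) opprB Lk.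
    by rewrite subrKA.
  apply: (le_trans (sqnD_le sip2 _ _)); rewrite (sqnN sip2).
  have h1 := le_trans (p_le (amplify m (w - k))) (mC' (w - k)).
  have h2 := mC' (p (w - k)).
  have h3 : C * q2 (p (w - k)) <= C * q2 (w - k) by rewrite ler_wpM2l// p_le.
  have h4 : C * q2 (w - k) <= C * e by rewrite ler_wpM2l.
  lra.
(* Without a unit, [eta] need not belong to [K]. However [sigma b] kills every coordinate of
   [eta - p eta] for all [b], so these are orthogonal to the dense orbit of [O]. *)
have p_eta : p eta = eta.
  apply/eqP; rewrite eq_sym -subr_eq0; apply/eqP/ell2_ext => i.
  apply: (dense_ext (K := range (fun b => sigma b O))).
    by move=> v; apply/closure_sqP; rewrite cyclic.
  move=> _ [b _ <-]; rewrite ell20E inner0r (sA b).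
  have Kb : K (amplify (sigma (star b)) eta) by exists (star b).
  have := congr1 (@^~ i \o ell2_seq) (p_sigma (star b) eta).
  rewrite p_fix//= !amplifyE// => eta_b.
  transitivity (inner O (sigma (star b) (eta i - p eta i))) => //.
  by rewrite (linB (sb (star b)).1) eta_b subrr inner0r.
move=> e e0.
have [_ [b _ <-] lt_e] := p_adh (amplify m eta) _ e0.
by exists b; move: lt_e; rewrite pm p_eta.
Qed.

End Density.

(** * Sigma-weak functionals in terms of l2(H) *)

Section SigmaWeakTopology.
Context {R : realType} {H : hilbertType R}.
Implicit Types (x : H -> H) (w : nat -> H).
Local Notation q2 := (sqn (@ell2_inner R H)).
Local Notation sip2 := (@ell2_inner_sip R H).

Lemma square_summable_series w n : series (fun i => `|w i| ^+ 2 : Cplx R) n = ofR (sq_series w n).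
Proof.
rewrite /sq_series /series /= /ofR rmorph_sum /=.
by apply: eq_bigr => i _; exact: norm_sq.
Qed.

Lemma square_summable_ell2 w : square_summable w -> w \in ell2_pred.
Proof.
move=> /cvg_ex[l /ccvg_nP /(_ _ ltr01)[N NP]]; apply/asboolP.
exists (re l + 1) => n.
apply: le_trans (sq_series_mono w (leq_maxl n N)) _.
have := NP _ (leq_maxr n N); rewrite square_summable_series /csq !reimE.
set a := sq_series _ _; have := sqr_ge0 (0 - im l); nra.
Qed.

(** Sequences with one nonzero term make matrix coefficients a special case of sigma-weak
    functionals. *)
Lemma square_summable_delta (v : H) : square_summable (ell2_delta 0 v).
Proof.
apply/cvg_ex; exists (ofR (sq v)); apply/ccvg_nP => e e0; exists 1%N => -[//|n] _.
rewrite square_summable_series.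
have -> : sq_series (ell2_delta 0 v) n.+1 = sq v.
  elim: n => [|n IH]; rewrite sq_seriesS ell2_deltaE ?sq_series0 ?add0r//=.
  by rewrite IH sq0 addr0.
by rewrite subrr /csq !reimE expr0n addr0.
Qed.

Lemma sigma_weak_ell2 x (u v : ell2) : bounded_operator x ->
  sigma_weak_functional u v x = ell2_inner u (amplify x v).
Proof.
move=> xb; rewrite /sigma_weak_functional /ell2_inner.
have -> // : (fun n => inner (u n) (x (v n))) = (fun n => inner (u n) (amplify x v n)).
by apply/funext => n; rewrite amplifyE.
Qed.

Lemma sigma_weak_delta x (u v : H) : linear x ->
  sigma_weak_functional (ell2_delta 0 u) (ell2_delta 0 v) x = inner u (x v).
Proof.
move=> x_lin; apply: cvg_lim => //.
apply/ccvg_nP => e e0; exists 1%N => -[//|n] _.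
have -> : series (fun n => inner (ell2_delta 0 u n) (x (ell2_delta 0 v n))) n.+1
    = inner u (x v).
  elim: n => [|n IH].
    by rewrite /series /= big_nat_recr //= big_geq// add0r !ell2_deltaE.
  move: IH; rewrite /series /= => IH; rewrite big_nat_recr //= IH.
  by rewrite !ell2_deltaE/= (lin0 x_lin) inner0r addr0.
by rewrite subrr /csq !reimE expr0n addr0.
Qed.

(** Merges two sequences into one, so that closeness on the merged sequence controls both. This
    makes the sets of [sigma_weak_approx] stable under intersection. *)
Definition interlace (u v : nat -> H) : nat -> H :=
  fun n => if odd n then v n./2 else u n./2.

Lemma sq_series_interlace u v n :
  sq_series (interlace u v) n.*2 = sq_series u n + sq_series v n.
Proof.
elim: n => [|n IH]; first by rewrite double0 !sq_series0 addr0.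
rewrite doubleS !sq_seriesS IH /interlace /= odd_double /= uphalf_double doubleK.
lra.
Qed.

Lemma interlace_ell2 (u v : ell2) : interlace u v \in ell2_pred.
Proof.
have [M uM] := ell2P u; have [N vN] := ell2P v.
apply/asboolP; exists (M + N) => n.
apply: le_trans (sq_series_mono _ (_ : n <= n.*2)%N) _.
  by rewrite -addnn leq_addr.
by rewrite sq_series_interlace lerD.
Qed.

Lemma interlace_le (x y : H -> H) (u v : ell2) (w : ell2) :
  bounded_operator x -> bounded_operator y -> ell2_seq w = interlace u v ->
  q2 (amplify x u - amplify y u) <= q2 (amplify x w - amplify y w) /\
  q2 (amplify x v - amplify y v) <= q2 (amplify x w - amplify y w).
Proof.
move=> xb yb wE.
have dE (t : ell2) : ell2_seq (amplify x t - amplify y t) = (fun i => x (t i) - y (t i)).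
  by apply/funext => i; rewrite -(amplifyE t i xb) -(amplifyE t i yb).
have h n : sq_series (amplify x u - amplify y u) n + sq_series (amplify x v - amplify y v) n
    <= q2 (amplify x w - amplify y w).
  apply: le_trans (sq_series_le _ n.*2).
  rewrite !dE wE -sq_series_interlace le_eqVlt; apply/orP; left.
  apply/eqP; congr (sq_series _ _); apply/funext => i; rewrite /interlace.
  by case: ifP.
split; apply: ell2_sqn_le => n; apply: le_trans (h n).
  by rewrite lerDl sq_series_ge0.
by rewrite lerDr sq_series_ge0.
Qed.

End SigmaWeakTopology.

(** * Invariance of a vector state under a normal map *)

Section NormalMaps.
Context {R : realType} {A : cstarType R} {H : hilbertType R}.
Context (sigma : A -> H -> H) (O : H).
Hypothesis sigma_rep : representation sigma.
Hypothesis cyclic : closure [set sigma a O | a in [set: A]] = [set: H].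
Local Notation q2 := (sqn (@ell2_inner R H)).
Local Notation sip2 := (@ell2_inner_sip R H).

(** The trace on the range of [sigma] of the sigma-strong neighbourhoods of [m]. The density theorem
    makes this filter proper, and Cauchy-Schwarz in l2(H) gives its sigma-weak convergence. *)
Definition sigma_weak_approx (m : H -> H) : set_system (H -> H) :=
  [set B | exists eta : ell2, exists2 e : R, 0 < e &
     forall b, q2 (amplify (sigma b) eta - amplify m eta) < e -> B (sigma b)].

Lemma sigma_weak_approx_proper m : bicommutant (range sigma) m ->
  ProperFilter (sigma_weak_approx m).
Proof.
move=> mM; have mb := mM.1; have [sb _ _ _] := sigma_rep; split.
  move=> [eta [e e0]] B0; have [b lt_e] := sigma_weak_density sigma_rep cyclic eta mM e0.
  by apply: (B0 b); rewrite (sqnBC sip2).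
split.
- by exists 0; exists 1.
- move=> B C [u [d d0 uB]] [v [e e0 vC]].
  exists (Ell2 (interlace_ell2 u v)); exists (Num.min d e); first by rewrite lt_min d0.
  move=> b; rewrite lt_min => /andP[lt_d lt_e].
  have [h1 h2] := interlace_le (sb b) mb (erefl : ell2_seq (Ell2 (interlace_ell2 u v)) = _).
  by split; [apply: uB; exact: le_lt_trans lt_d|apply: vC; exact: le_lt_trans lt_e].
- by move=> B C BC [u [d d0 uB]]; exists u; exists d => // b /uB; exact: BC.
Qed.

Lemma sigma_weak_approx_cvg m : bicommutant (range sigma) m ->
  sigma_weak_cvg (sigma_weak_approx m) m.
Proof.
move=> mM; have mb := mM.1; have [sb _ _ _] := sigma_rep.
have Fproper := sigma_weak_approx_proper mM.
move=> xi eta /square_summable_ell2 xi2 /square_summable_ell2 eta2.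
apply/(ccvg_sqP (F := sigma_weak_approx m)) => e e0.
pose u := Ell2 xi2; pose v := Ell2 eta2.
have u1 : 0 < q2 u + 1 by rewrite ltr_wpDl// (sqn_ge0 sip2).
exists v; exists (e / (q2 u + 1)); first exact: divr_gt0.
move=> b; rewrite ltr_pdivlMr// => lt_e /=.
rewrite (sigma_weak_ell2 u v (sb b)) (sigma_weak_ell2 u v mb).
have -> : ell2_inner u (amplify (sigma b) v) - ell2_inner u (amplify m v)
    = ell2_inner u (amplify (sigma b) v - amplify m v).
  by rewrite (ipDr sip2) (ipNr sip2).
apply: (le_lt_trans (cauchy_schwarz sip2 _ _)); apply: le_lt_trans lt_e.
by rewrite mulrDr mulr1 mulrC lerDl (sqn_ge0 sip2).
Qed.

(** Some [sigma b] in the filter is close to [m] for the coefficient at [O], while [Phi (sigma b)]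
    is close to [Phi m]; the two coefficients agree at [sigma b]. *)
Lemma normal_map_invariant (Phi : (H -> H) -> (H -> H)) :
  (forall x, bicommutant (range sigma) x -> linear (Phi x)) ->
  normal_map (bicommutant (range sigma)) Phi ->
  (forall b, inner O (Phi (sigma b) O) = inner O (sigma b O)) ->
  forall m, bicommutant (range sigma) m -> inner O (Phi m O) = inner O (m O).
Proof.
move=> Phi_lin Phi_normal inv m mM.
have Fproper := sigma_weak_approx_proper mM.
have Fcvg := sigma_weak_approx_cvg mM.
have range_M := sub_bicommutant (rep_star_closed sigma_rep).
have FM : sigma_weak_approx m (bicommutant (range sigma)).
  by exists 0; exists 1 => // b _; apply: range_M; exists b.
have Fr : sigma_weak_approx m (range sigma) by exists 0; exists 1 => // b _; exists b.
have := Phi_normal _ _ Fproper FM mM Fcvg.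
move=> /(_ _ _ (@square_summable_delta _ _ O) (@square_summable_delta _ _ O)).
move=> /(ccvg_sqP (F := Phi @ sigma_weak_approx m)) Phi_cvg.
have := Fcvg _ _ (@square_summable_delta _ _ O) (@square_summable_delta _ _ O).
move=> /(ccvg_sqP (F := sigma_weak_approx m)) m_cvg.
apply/eqP; rewrite -subr_eq0; apply/eqP/csq_eq0.
apply: (@eq0_small _ _ 4); first exact: csq_ge0.
move=> e e0.
have {}Phi_cvg : sigma_weak_approx m (Phi @^-1` [set y | csq
    (sigma_weak_functional (ell2_delta 0 O) (ell2_delta 0 O) y -
     sigma_weak_functional (ell2_delta 0 O) (ell2_delta 0 O) (Phi m)) < e]).
  exact: Phi_cvg _ e0.
have FF : Filter (sigma_weak_approx m) by exact: filter_filter.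
have [x [[xM [b _ xb]] [/= Phi_x m_x]]] := @filter_ex _ _ Fproper _
  (@filterI _ _ FF _ _ (@filterI _ _ FF _ _ FM Fr)
     (@filterI _ _ FF _ _ Phi_cvg (m_cvg _ e0))).
move: Phi_x m_x; rewrite !sigma_weak_delta;
  do ?[exact: Phi_lin|exact: mM.1.1|exact: xM.1.1].
rewrite -xb inv => /ltW Phi_x /ltW m_x.
have -> : inner O (Phi m O) - inner O (m O)
    = - (inner O (sigma b O) - inner O (Phi m O)) + (inner O (sigma b O) - inner O (m O)).
  by rewrite opprB subrKA.
apply: (le_trans (csqD_le _ _)); rewrite csqN; lra.
Qed.

End NormalMaps.

(** * The dynamical system *)

Section TimeFilters.
Context (T : realDomainType).

Lemma to_pinfty_proper : ProperFilter (to_pinfty T).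
Proof.
split; first by move=> [s /(_ s (lexx s))].
split; first by exists 0.
  move=> A B [s sA] [t tB]; exists (Num.max s t) => r.
  by rewrite ge_max => /andP[/sA ? /tB ?]; split.
by move=> A B AB [s sA]; exists s => t /sA; exact: AB.
Qed.

Lemma to_minfty_proper : ProperFilter (to_minfty T).
Proof.
split; first by move=> [s /(_ s (lexx s))].
split; first by exists 0.
  move=> A B [s sA] [t tB]; exists (Num.min s t) => r.
  by rewrite le_min => /andP[/sA ? /tB ?]; split.
by move=> A B AB [s sA]; exists s => t /sA; exact: AB.
Qed.

End TimeFilters.

Section Preliminaries.
Context {R : realType}.

Lemma projection_le (H : hilbertType R) (p : H -> H) v : projection p -> sq (p v) <= sq v.
Proof.
move=> [[p_lin _] pp pA].
have po : inner (p v) (v - p v) = 0.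
  by rewrite pA (linB p_lin) -[p (p v)]/((p \o p) v) pp subrr inner0r.
have -> : sq v = sq (p v + (v - p v)) by rewrite addrC subrK.
by rewrite {2}/sq (sqnD (inner_sip H)) po mulr0 addr0 lerDl (sqn_ge0 (inner_sip H)).
Qed.

(** Norms by duality: testing [x] against nearby vectors [k] of [K] recovers its full norm. *)
Lemma sq_le_dense (H : hilbertType R) (K : set H) x (C : R) : 0 <= C ->
  adherent inner K x -> (forall k, K k -> csq (inner x k) <= C * sq k) -> sq x <= C.
Proof.
move=> C0 xK le_C; apply/ler_addgt0Pr => e e0.
have [k Kk] := xK _ e0; rewrite -/(sq (x - k)) => xk.
have xkE : sq (x - k) = sq x + sq k - 2 * re (inner x k).
  by rewrite /sq (sqnD (inner_sip H)) (sqnN (inner_sip H)) innerNr reN; lra.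
have := le_C _ Kk; rewrite /csq => le_k.
have re_k : re (inner x k) ^+ 2 <= C * sq k.
  by apply: le_trans le_k; rewrite lerDl sqr_ge0.
have k_ge0 := sq_ge0 k; have xk_ge0 := sq_ge0 (x - k).
have [k0|k_neq0] := eqVneq (sq k) 0.
  have r0 : re (inner x k) = 0.
    by apply/eqP; rewrite -sqrf_eq0 eq_le sqr_ge0 andbT -[leRHS](mulr0 C) -k0.
  by rewrite k0 r0 in xkE; lra.
have k_gt0 : 0 < sq k by rewrite lt_def k_neq0.
(* With D this difference, re <x, k> = (D + |k|^2) / 2, whose square is at least D |k|^2 by the
   arithmetic-geometric inequality. *)
suff : sq x - sq (x - k) <= C by lra.
rewrite -(ler_pM2r k_gt0); apply: le_trans re_k.
have -> : re (inner x k) = (sq x - sq (x - k) + sq k) / 2 by rewrite xkE; lra.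
have := sqr_ge0 (sq x - sq (x - k) - sq k).
nra.
Qed.

Lemma star_hom_comp (A B C : cstarType R) (f : B -> C) (g : A -> B) :
  star_hom f -> star_hom g -> star_hom (f \o g).
Proof.
move=> [fl fM fs] [gl gM gs]; split.
- by move=> a x y /=; rewrite gl fl.
- by move=> x y /=; rewrite gM fM.
- by move=> x /=; rewrite gs fs.
Qed.

Lemma representation_comp (A B : cstarType R) (H : hilbertType R)
    (pi : B -> H -> H) (f : A -> B) :
  representation pi -> star_hom f -> representation (pi \o f).
Proof.
move=> [pb pl pM pA] [fl fM fs]; split => //=.
- by move=> c a b; rewrite fl pl.
- by move=> a b; rewrite fM pM.
- by move=> a; rewrite fs.
Qed.

(** |pi a O|^2 = phi (a* a) <= |a* a| = |a|^2. This turns norm density in the algebra into density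
    of orbits. *)
Lemma state_sq_le (A : cstarType R) (phi : A -> Cplx R) (H : hilbertType R)
    (pi : A -> H -> H) (O : H) a :
  state phi -> gns_triple phi pi O -> ofR (sq (pi a O)) <= `|a| ^+ 2.
Proof.
move=> [_ _ phi_le _] [pi_rep _ phiE].
rewrite -cstar_identity; apply: le_trans (phi_le _).
rewrite phiE /vector_functional -(rep_inner pi_rep).
by rewrite (ip_sqn (inner_sip H)) ger0_norm// (ofR_le 0) sq_ge0.
Qed.

Lemma commutant_sub (H : hilbertType R) (S S' : set (H -> H)) :
  S `<=` S' -> commutant S' `<=` commutant S.
Proof. by move=> SS x [xb xS]; split => // y /SS; exact: xS. Qed.

End Preliminaries.

Section EndomorphismInvariance.
Context {R : realType} {A : cstarType R} {H : hilbertType R}.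
Context (sigma : A -> H -> H) (O : H) (Phi : (H -> H) -> (H -> H)).
Hypothesis sigma_rep : representation sigma.
Hypothesis cyclic : closure [set sigma a O | a in [set: A]] = [set: H].
Local Notation M := (bicommutant (range sigma)).
Hypothesis Phi_endo : operator_endomorphism M Phi.
Hypothesis Phi_normal : normal_map M Phi.
Hypothesis Phi_inv : forall b, inner O (Phi (sigma b) O) = inner O (sigma b O).

(** Apply the invariance to the product of the adjoint of [m] with [m], which [Phi] respects. *)
Lemma endomorphism_sq m : M m -> sq (Phi m O) = sq (m O).
Proof.
move=> mM; have [PhiM _ PhiC PhiA] := Phi_endo.
have Mstar := bicommutant_star_closed (rep_star_closed sigma_rep).
have [mb [n nM mn]] := Mstar _ mM.
rewrite /sq /sqn (PhiA _ _ mM nM mn) mn.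
rewrite -[Phi n (Phi m O)]/((Phi n \o Phi m) O) -PhiC//.
rewrite (normal_map_invariant sigma_rep cyclic (Phi := Phi))//.
  by move=> x /PhiM xM; have [[]] := Mstar _ xM.
exact: commutant_comp.
Qed.

End EndomorphismInvariance.

Lemma rep_sub (R : realType) (A : cstarType R) (H : hilbertType R)
    (sigma : A -> H -> H) a b v :
  representation sigma -> sigma (a - b) v = sigma a v - sigma b v.
Proof.
move=> [_ sl _ _]; have -> : a - b = -1 *: b + a by rewrite scaleN1r addrC.
by rewrite sl !fctE scaleN1r addrC.
Qed.

(** * The embeddings of the GNS space of [psi] at each time *)

Section TailEmbeddings.
Context {R : realType} {T : realDomainType} {B0 B : cstarType R}.
Context (lam : T -> B0 -> B0) (psi : B0 -> Cplx R).
Context (alpha : T -> B -> B) (i0 : B0 -> B) (psi_inf : B -> Cplx R).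
Context {H H0 : hilbertType R} (pi : B -> H -> H) (Omega : H).
Context (pi0 : B0 -> H0 -> H0) (Omega0 : H0).
Hypothesis B_limit : inductive_limit lam alpha i0.
Hypothesis psi_inf_state : state psi_inf.
Hypothesis psi_inf_inv : invariant_on setT alpha psi_inf.
Hypothesis psi_inf_i0 : psi_inf \o i0 = psi.
Hypothesis pi_gns : gns_triple psi_inf pi Omega.
Hypothesis pi0_gns : gns_triple psi pi0 Omega0.

Definition tail_rep (t : T) (b : B0) : H -> H := pi (alpha t (i0 b)).

Lemma tail_rep_rep t : representation (tail_rep t).
Proof.
have [[ah _ _] [ih _] _ _] := B_limit; have [pr _ _] := pi_gns.
apply: (representation_comp (f := alpha t \o i0)) => //.
exact: star_hom_comp.
Qed.

Lemma tail_rep_state t b :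
  inner Omega (tail_rep t b Omega) = inner Omega0 (pi0 b Omega0).
Proof.
have [_ _ piE] := pi_gns; have [_ _ pi0E] := pi0_gns.
rewrite -[LHS]/(vector_functional Omega _) -piE.
rewrite -[RHS]/(vector_functional Omega0 _) -pi0E -psi_inf_i0 /=.
by rewrite -[in RHS](psi_inf_inv (I : setT t)).
Qed.

Lemma range_tail_rep t : range (tail_rep t) = pi @` tail_algebra alpha i0 t.
Proof.
apply/seteqP; split.
  by move=> _ [b _ <-]; exists (alpha t (i0 b)) => //; exists (i0 b) => //; exists b.
by move=> _ [_ [_ [b _ <-] <-] <-]; exists b.
Qed.

Lemma tail_rep_shift s t b : 0 <= t -> tail_rep (s - t) (lam t b) = tail_rep s b.
Proof.
move=> t0; have [[_ _ aD] _ comm _] := B_limit; rewrite /tail_rep.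
rewrite -[i0 (lam t b)]/((i0 \o lam t) b) -comm// /=.
by rewrite -[alpha (s - t) _]/((alpha (s - t) \o alpha t) (i0 b)) -aD subrK.
Qed.

Lemma tail_orbit_dense v :
  adherent inner [set tail_rep p.1 p.2 Omega | p in [set: T * B0]] v.
Proof.
have [pi_rep pi_cyclic _] := pi_gns.
have [_ _ _ dense] := B_limit.
apply: (adherent_idem (inner_sip H)) => e e0.
have [|_ [a _ <-] av] := (closure_sqP [set pi a Omega | a in [set: B]] v).1 _ _ e0.
  by rewrite pi_cyclic.
exists (pi a Omega) => // d d0.
have normE (c : B) : `|c| ^+ 2 = ofR (re (`|c| ^+ 2)) by apply/ofR_re/exprn_ge0.
have : closure (\bigcup_t tail_algebra alpha i0 t) a by rewrite dense.
move=> /(closure_sqnormP normE) /(_ _ d0)[_ [t _ [_ [b0 _ <-] <-]] ab].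
exists (tail_rep t b0 Omega); first by exists (t, b0).
apply: le_lt_trans ab; rewrite -ofR_le -normE.
have -> : pi a Omega - tail_rep t b0 Omega = pi (a - alpha t (i0 b0)) Omega.
  by rewrite (rep_sub _ _ _ pi_rep).
exact: state_sq_le _ psi_inf_state pi_gns.
Qed.

(** Corresponding orbit vectors have equal norms and equal inner products with [Omega] and [Omega0].
    Since each vector is adherent to its orbits, [sq_le_dense] bounds either norm by the other. *)
Lemma gns_vectors_sq : sq Omega = sq Omega0.
Proof.
have [pi0_rep pi0_cyclic _] := pi0_gns.
have sq_tail t b : sq (tail_rep t b Omega) = sq (pi0 b Omega0).
  by rewrite /sq /sqn (rep_inner (tail_rep_rep t)) (rep_inner pi0_rep) tail_rep_state.
apply/eqP; rewrite eq_le; apply/andP; split.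
  apply: (sq_le_dense (sq_ge0 _) (tail_orbit_dense _)) => _ [[t b] _ <-] /=.
  by rewrite tail_rep_state sq_tail csq_inner_le.
apply: (sq_le_dense (sq_ge0 _) (K := range (fun a => pi0 a Omega0))).
  exact: cyclic_dense.
move=> _ [b _ <-] /=.
by rewrite -(tail_rep_state 0) -(sq_tail 0) csq_inner_le.
Qed.

Lemma tail_embedding_exists : exists V : T -> H0 -> H,
  forall t, intertwiner pi0 (tail_rep t) Omega0 Omega (V t).
Proof.
have [pi0_rep pi0_cyclic _] := pi0_gns.
suff /choice[V VP] : forall t, exists V, intertwiner pi0 (tail_rep t) Omega0 Omega V.
  by exists V.
move=> t; apply: intertwiner_exists => //; [exact: tail_rep_rep|exact: tail_rep_state|].
exact: gns_vectors_sq.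
Qed.

End TailEmbeddings.

(** * The limit of the decreasing support projections *)

Section DecreasingSupports.
Context {R : realType} {T : realDomainType} {H : hilbertType R}.
Context (N : T -> set (H -> H)) (Omega : H) (F : T -> H -> H) (Q : H -> H).
Hypothesis N_decr : forall s t, t <= s -> N s `<=` N t.
Hypothesis F_support : forall t,
  support_projection (bicommutant (N t)) (vector_functional Omega) (F t).
Hypothesis Q_lim : forall xi, F t xi @[t --> to_minfty T] --> Q xi.

(** For [t <= s], [F s] also lies in the larger bicommutant of [N t] and has full mass on [Omega],
    so the minimality of [F t] applies to it. *)
Lemma support_le s t v : t <= s -> F s (F t v) = F t v.
Proof.
move=> ts; have [_ _ _ min_t] := F_support t.
have [proj_s Ms phi_s _] := F_support s.
rewrite -[LHS]/((F s \o F t) v) min_t//.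
by apply: commutant_sub (commutant_sub (N_decr ts)) _ Ms.
Qed.

Lemma support_limit v (e : R) : 0 < e ->
  exists s, forall t, t <= s -> sq (F t v - Q v) < e.
Proof.
move=> e0; have FF : Filter (to_minfty T) by have [] := to_minfty_proper T.
by have /(cvg_sqP FF) /(_ _ e0) := Q_lim (xi := v).
Qed.

Lemma support_adjoint t u v : inner (F t u) v = inner u (F t v).
Proof. by have [[_ _ FA] _ _ _] := F_support t. Qed.

Lemma limit_adjoint : adjoint Q Q.
Proof.
move=> u v; apply/eqP; rewrite -subr_eq0; apply/eqP/csq_eq0.
apply: (@eq0_small _ _ (2 * sq v + 2 * sq u)); first exact: csq_ge0.
move=> e e0; have [s1 h1] := support_limit u e0; have [s2 h2] := support_limit v e0.
have [t [t1 t2]] : exists t, t <= s1 /\ t <= s2.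
  by exists (Num.min s1 s2); rewrite !ge_min !lexx orbT.
have {}h1 := ltW (h1 _ t1); have {}h2 := ltW (h2 _ t2).
have -> : inner (Q u) v - inner u (Q v) = inner (Q u - F t u) v + inner u (F t v - Q v).
  by rewrite !innerDl !innerDr !innerNl !innerNr support_adjoint subrKA.
apply: (le_trans (csqD_le _ _)); rewrite [leRHS]mulrDl -!mulrA.
apply: lerD; rewrite ler_pM2l//.
  rewrite mulrC; apply: (le_trans (csq_inner_le _ _)); rewrite sqBC.
  by rewrite ler_wpM2r// sq_ge0.
by apply: (le_trans (csq_inner_le _ _)); rewrite ler_wpM2l// sq_ge0.
Qed.

Lemma support_limit_fix s v : F s (Q v) = Q v.
Proof.
apply/eqP; rewrite -subr_eq0; apply/eqP/sq_eq0.
apply: (@eq0_small _ _ 4); first exact: sq_ge0.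
move=> e e0; have [r h] := support_limit v e0.
have [[[F_lin _] _ _] _ _ _] := F_support s.
have [t [tr ts]] : exists t, t <= r /\ t <= s.
  by exists (Num.min r s); rewrite !ge_min !lexx orbT.
have {}h := ltW (h _ tr).
have -> : F s (Q v) - Q v = F s (Q v - F t v) + (F t v - Q v).
  by rewrite (linB F_lin) support_le// subrKA.
apply: (le_trans (sqD_le _ _)).
have [Fproj _ _ _] := F_support s.
have := projection_le (Q v - F t v) Fproj.
rewrite [in leRHS]sqBC; lra.
Qed.

(** The adjoint of [support_limit_fix], by self-adjointness of [Q] and [F s]. *)
Lemma limit_support s v : Q (F s v) = Q v.
Proof.
apply: inner_extr => u; rewrite -limit_adjoint -support_adjoint.
by rewrite support_limit_fix limit_adjoint.
Qed.

End DecreasingSupports.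

Theorem theorem4p2 (R : realType) (k : time_kind)
  (* the dynamical system (B_0, lambda_t, psi) *)
  (B0 : cstarType R) (lam : time R k -> B0 -> B0) (psi : B0 -> Cplx R)
  (lam_semigroup : injective_endomorphism_semigroup lam)
  (psi_state : state psi)
  (psi_inv : invariant_on [set t | 0 <= t] lam psi)
  (* its inductive limit, with the invariant state psi_{-oo} *)
  (B : cstarType R) (alpha : time R k -> B -> B) (i0 : B0 -> B)
  (B_limit : inductive_limit lam alpha i0)
  (psi_inf : B -> Cplx R)
  (psi_inf_state : state psi_inf)
  (psi_inf_inv : invariant_on setT alpha psi_inf)
  (psi_inf_i0 : psi_inf \o i0 = psi)
  (* the GNS triple of psi_{-oo}, the projections F_t] and Q *)
  (H : hilbertType R) (pi : B -> H -> H) (Omega : H)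
  (pi_gns : gns_triple psi_inf pi Omega)
  (F : time R k -> H -> H)
  (F_support : forall t, support_projection
     (bicommutant (pi @` tail_algebra alpha i0 t)) (vector_functional Omega)
     (F t))
  (Q : H -> H)
  (Q_lim : forall xi, F t xi @[t --> to_minfty (time R k)] --> Q xi)
  (* the GNS triple of psi and the normal extension of lambda_t, t >= 0 *)
  (H0 : hilbertType R) (pi0 : B0 -> H0 -> H0) (Omega0 : H0)
  (pi0_gns : gns_triple psi pi0 Omega0)
  (Lam : time R k -> (H0 -> H0) -> (H0 -> H0))
  (Lam_endo : forall t, 0 <= t ->
     operator_endomorphism (bicommutant (range pi0)) (Lam t))
  (Lam_normal : forall t, 0 <= t ->
     normal_map (bicommutant (range pi0)) (Lam t))
  (Lam_ext : forall t b, 0 <= t -> Lam t (pi0 b) = pi0 (lam t b))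
  (* the support projection of psi *)
  (P : H0 -> H0)
  (P_support : support_projection
     (bicommutant (range pi0)) (vector_functional Omega0) P) :
  let A0 := reduced_algebra (bicommutant (range pi0)) P in
  let tau := reduced_semigroup Lam P in
  let psi0 := reduced_state (vector_functional Omega0) P in
  Q = ket_bra Omega Omega <->
  (forall x y, A0 x -> A0 y ->
     psi0 (tau t x \o tau t y) @[t --> to_pinfty (time R k)]
       --> psi0 x * psi0 y).
Proof.
have [pi0_rep pi0_cyclic pi0E] := pi0_gns.
have [V V_int] := tail_embedding_exists B_limit psi_inf_state psi_inf_inv
  psi_inf_i0 pi_gns pi0_gns.
pose rho := tail_rep alpha i0 pi.
pose N t := pi @` tail_algebra alpha i0 t.
have N_decr s t : t <= s -> N s `<=` N t.
  by move=> ts; apply: image_subset; exact: tail_algebra_decreasing B_limit ts.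
have rho_rep t : representation (rho t) by exact: tail_rep_rep B_limit pi_gns t.
have V_iso t : isometry (V t) by have [] := V_int t.
have V_Omega t : V t Omega0 = Omega by have [] := V_int t.
have V_lin t : linear (V t) by have [] := isometry_bounded (V_iso t).
have V_pi0 t b : V t (pi0 b Omega0) = rho t b Omega.
  by have [_ VO ->] := V_int t; rewrite VO.
have VP t v : V t (P v) = F t (V t v).
  apply: intertwiner_support (V_int t) P_support _ v => //.
  by rewrite range_tail_rep; exact: F_support.
have Mstar := bicommutant_star_closed (rep_star_closed pi0_rep).
have pi0M b : bicommutant (range pi0) (pi0 b).
  by apply: sub_bicommutant; [exact: rep_star_closed|exists b].
have PM : bicommutant (range pi0) P by have [] := P_support.
have [[_ PP PA] _ _ _] := P_support.
have PPE v : P (P v) = P v by rewrite -[LHS]/((P \o P) v) PP.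
have PO : P Omega0 = Omega0 := support_fix P_support.
have FO t : F t Omega = Omega := support_fix (F_support t).
have Lam_sq t m : 0 <= t -> bicommutant (range pi0) m ->
    sq (Lam t m Omega0) = sq (m Omega0).
  move=> t0; apply: (endomorphism_sq pi0_rep pi0_cyclic (Lam_endo t t0) (Lam_normal t t0)).
  move=> b; rewrite Lam_ext// -2![inner _ _]/(vector_functional Omega0 _) -!pi0E.
  exact: (congr1 (@^~ b) (psi_inv _ t0)).
have V_Lam s t m : 0 <= t -> bicommutant (range pi0) m ->
    V (s - t) (Lam t m Omega0) = V s (m Omega0).
  move=> t0 mM; have [_ LamL _ _] := Lam_endo t t0.
  apply/eqP; rewrite -subr_eq0; apply/eqP/sq_eq0.
  (* 4 = 2 + 2: after approximating [m Omega0] by [pi0 b Omega0], the two remaining terms have the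
     same squared norm, the first by [Lam_sq] applied to the difference. *)
  apply: (@eq0_small _ _ 4); first exact: sq_ge0.
  move=> e e0; have [_ [b _ <-]] := cyclic_dense pi0_cyclic (m Omega0) e0.
  rewrite -/(sq _) => /ltW mb.
  have LamB : Lam t (-1 *: pi0 b + m) = -1 *: Lam t (pi0 b) + Lam t m by exact: LamL.
  have diffM : bicommutant (range pi0) (-1 *: pi0 b + m).
    exact: commutant_lin (commutant_star_closed (rep_star_closed pi0_rep)) (pi0M b) mM.
  have -> : V (s - t) (Lam t m Omega0) - V s (m Omega0)
      = V (s - t) (Lam t (-1 *: pi0 b + m) Omega0) + V s (pi0 b Omega0 - m Omega0).
    rewrite LamB !fctE scaleN1r addrC (linB (V_lin _)) (linB (V_lin _)) Lam_ext//.
    by rewrite !V_pi0 /rho (tail_rep_shift pi B_limit)// subrKA.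
  have sqV r w : sq (V r w) = sq w by rewrite /sq /sqn V_iso.
  apply: (le_trans (sqD_le _ _)); rewrite !sqV Lam_sq// !fctE scaleN1r addrC.
  by rewrite [X in _ + 2 * X]sqBC; lra.
have A0E x : reduced_algebra (bicommutant (range pi0)) P x ->
    [/\ bicommutant (range pi0) x, P \o x \o P = x &
      exists2 x', bicommutant (range pi0) x' & adjoint x x'].
  move=> [m mM <-].
  have xM : bicommutant (range pi0) (P \o m \o P).
    by apply: commutant_comp => //; exact: commutant_comp.
  split=> //; first by apply/funext => v /=; rewrite !PPE.
  by have [] := Mstar _ xM.
have correlation s t x x' y : 0 <= t -> reduced_algebra (bicommutant (range pi0)) P x ->
    reduced_algebra (bicommutant (range pi0)) P y -> bicommutant (range pi0) x' ->
    adjoint x x' ->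
    reduced_state (vector_functional Omega0) P
      (reduced_semigroup Lam P t x \o reduced_semigroup Lam P t y)
    = inner (V s (x' Omega0)) (F (s - t) (V s (y Omega0))).
  move=> t0 /A0E[xM xP _] /A0E[yM yP _] x'M xx'.
  have [_ _ _ LamA] := Lam_endo t t0.
  (* Both vectors are written as images under [V (s - t)], where [F (s - t)] pulls back to [P]. The
     isometry then cancels, and [Lam t x'] crosses over as its adjoint [Lam t x]. *)
  rewrite -(V_Lam s t x')// -(V_Lam s t y)// -VP V_iso.
  rewrite (adjoint_sym (LamA _ _ xM x'M xx')).
  rewrite /reduced_state /reduced_semigroup xP yP /vector_functional /= !PPE PO.
  by rewrite -!PA PO.
move=> A0 tau psi0.
have psi0E x x' s : A0 x -> bicommutant (range pi0) x' -> adjoint x x' ->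
    psi0 x = inner (V s (x' Omega0)) Omega.
  move=> /A0E[xM xP _] x'M xx'.
  by rewrite -(V_Omega s) V_iso (adjoint_sym xx') /psi0 /reduced_state xP.
have psi0E' y s : A0 y -> psi0 y = inner Omega (V s (y Omega0)).
  move=> /A0E[yM yP _].
  by rewrite -(V_Omega s) V_iso /psi0 /reduced_state yP.
have Flim s x x' y (e : R) : A0 x -> A0 y -> bicommutant (range pi0) x' ->
    adjoint x x' -> 0 < e -> exists r, forall t, r <= t ->
    csq (psi0 (tau t x \o tau t y) - inner (V s (x' Omega0)) (Q (V s (y Omega0)))) < e.
  move=> xA yA x'M xx' e0; set u := V s (x' Omega0); set v := V s (y Omega0).
  have u1 : 0 < sq u + 1 by rewrite ltr_wpDl// sq_ge0.
  have [r h] := support_limit Q_lim v (divr_gt0 e0 u1).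
  (* [0 <= t] makes [Lam t] available, and [s - r <= t] puts [s - t] below the threshold [r] of the
     limit defining [Q]. *)
  exists (Num.max 0 (s - r)) => t; rewrite ge_max => /andP[t0 rt].
  have str : s - t <= r by rewrite lerBlDr addrC -lerBlDr.
  rewrite /psi0 /tau (correlation s t x x' y)// -/u -/v -innerNr -innerDr.
  apply: (le_lt_trans (csq_inner_le _ _)).
  have := h _ str; rewrite ltr_pdivlMr// => lt_e; apply: le_lt_trans lt_e.
  by rewrite mulrDr mulr1 mulrC lerDl sq_ge0.
have FF : ProperFilter (to_pinfty (time R k)) by exact: to_pinfty_proper.
split=> [QE x y xA yA|lim_psi0].
  have [xM xP [x' x'M xx']] := A0E _ xA.
  apply/(ccvg_sqP (F := to_pinfty (time R k))) => e e0.
  (* Time 0 is an arbitrary choice: [psi0E] and [psi0E'] hold at every time [s]. *)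
  have [r h] := Flim 0 x x' y e xA yA x'M xx' e0; exists r => t /h.
  by rewrite QE /ket_bra innerZr mulrC -(psi0E x)// -psi0E'.
have Qinner s b c :
    inner (rho s b Omega) (Q (rho s c Omega))
    = inner (rho s b Omega) (ket_bra Omega Omega (rho s c Omega)).
  (* Compressing to the corner replaces the orbit vectors by their images under [F s], which [Q]
     absorbs on both sides. *)
  pose x := P \o pi0 (star b) \o P; pose x' := P \o pi0 b \o P.
  pose y := P \o pi0 c \o P.
  have xA : A0 x by exists (pi0 (star b)).
  have yA : A0 y by exists (pi0 c).
  have x'A : A0 x' by exists (pi0 b).
  have [x'M _ _] := A0E _ x'A.
  have xx' : adjoint x x'.
    have [_ _ _ pA] := pi0_rep.
    by move=> u v; rewrite /x /x' /= PA (adjoint_sym (pA b)) PA.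
  have Vx' : V s (x' Omega0) = F s (rho s b Omega).
    by rewrite /x' /= PO VP V_pi0.
  have Vy : V s (y Omega0) = F s (rho s c Omega).
    by rewrite /y /= PO VP V_pi0.
  have FA u v : inner (F s u) v = inner u (F s v) := support_adjoint F_support s u v.
  have lim_xy : psi0 x * psi0 y = inner (V s (x' Omega0)) (Q (V s (y Omega0))).
    apply/eqP; rewrite -subr_eq0; apply/eqP/csq_eq0.
    apply: (@eq0_small _ _ 4); first exact: csq_ge0.
    move=> e e0.
    have [r1 h1] := Flim s x x' y e xA yA x'M xx' e0.
    have /(ccvg_sqP (F := to_pinfty (time R k))) /(_ _ e0)[r2 h2] := lim_psi0 x y xA yA.
    have [t [/h1/ltW {}h1 /h2/ltW {}h2]] : exists t, r1 <= t /\ r2 <= t.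
      by exists (Num.max r1 r2); rewrite !le_max !lexx orbT.
    set X := psi0 (tau t x \o tau t y) in h1 h2.
    have -> : psi0 x * psi0 y - inner (V s (x' Omega0)) (Q (V s (y Omega0)))
        = - (X - psi0 x * psi0 y) + (X - inner (V s (x' Omega0)) (Q (V s (y Omega0)))).
      by rewrite opprB subrKA.
    by apply: (le_trans (csqD_le _ _)); rewrite csqN; lra.
  move: lim_xy; rewrite (psi0E x x' s)// (psi0E' y s)// Vx' Vy.
  rewrite (limit_support N_decr F_support Q_lim) !FA.
  rewrite (support_limit_fix N_decr F_support Q_lim) FO => <-.
  by rewrite -FA FO /ket_bra innerZr mulrC.
have rho_earlier r s b : r <= s -> exists c, rho s b = rho r c.
  move=> rs; exists (lam (s - r) b); rewrite /rho.
  by rewrite -{1}(tail_rep_shift pi B_limit s b (t := s - r)) ?subr_ge0// subKr.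
(* Two orbit vectors at different times both belong to the orbit at the earlier one, where [Qinner]
   applies. *)
have Qorbit s b r c :
    inner (rho s b Omega) (Q (rho r c Omega))
    = inner (rho s b Omega) (ket_bra Omega Omega (rho r c Omega)).
  have [/(rho_earlier _ _ c)[d ->]|/ltW/(rho_earlier _ _ b)[d ->]] := leP s r;
    exact: Qinner.
have dense := tail_orbit_dense B_limit psi_inf_state pi_gns.
have QA := limit_adjoint F_support Q_lim.
apply/funext => v; apply: (dense_ext dense) => _ [[s b] _ <-] /=.
(* Self-adjointness moves [Q] onto the orbit vector, so that the inner use of density compares two
   vectors by tests on the orbits alone. *)
rewrite -QA.
have -> : Q (tail_rep alpha i0 pi s b Omega)
    = ket_bra Omega Omega (tail_rep alpha i0 pi s b Omega).
  by apply: (dense_ext dense) => _ [[r c] _ <-] /=; exact: Qorbit.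
by rewrite /ket_bra innerZl innerZr -innerC mulrC.
Qed.
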